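(* Let $p>2$ be a real number and let $(X_i)_{i\in\mathbb Z}$ be a stationary sequence of random variables in $\mathbf L^p$, adapted to the filtration $(\mathcal F_i)_{i\in\mathbb Z}$ (setting described in the context). Let $\delta=\min(1,1/(p-2))$. Then there is a constant $C_p$ depending only on $p$ such that for every positive integer $n$, $$ \mathbf E\Bigl(\max_{1\le j\le n}|S_j|^p\Bigr)\le C_p\Biggl[ n\,\mathbf E(|X_1|^p)+c\,n\Biggl(\sum_{k=1}^{n}\frac{1}{k^{1+1/p}}\|\mathbf E_0(S_k)\|_p\Biggr)^{p}+n\Biggl(\sum_{k=1}^{n}\frac{1}{k^{1+2\delta/p}}\|\mathbf E_0(S_k^2)\|_{p/2}^{\delta}\Biggr)^{p/(2\delta)}\Biggr] $$ with $c=1$. Moreover, when $p\ge 4$, the inequality also holds with $c=0$ (for a possibly larger constant $C_p$ depending only on $p$).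
   Context: Setting: $(\Omega,\mathcal A,\mathbf P)$ is a probability space and $T:\Omega\to\Omega$ is a bijective bi-measurable transformation preserving $\mathbf P$. $\mathcal F_0\subseteq\mathcal A$ is a $\sigma$-algebra with $\mathcal F_0\subseteq T^{-1}(\mathcal F_0)$, and $\mathcal F_i=T^{-i}(\mathcal F_0)$, $i\in\mathbb Z$, is the resulting nondecreasing filtration. $X_0$ is a real-valued random variable and $X_i=X_0\circ T^i$. The sequence is called adapted if $X_0$ is $\mathcal F_0$-measurable. Notation: $\mathbf E_k(X)=\mathbf E(X\mid\mathcal F_k)$, $\|X\|_p$ is the norm in $\mathbf L^p$, $S_n=\sum_{j=1}^nX_j$. The constant $C_p$ does not depend on $n$ nor on the underlying random variables. *)

(* Defs.v *)
From HB Require Import structures.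
From mathcomp Require Import all_boot all_order all_algebra.
From mathcomp Require Import all_classical all_reals all_analysis.
From mathcomp Require Import measurable_realfun.

Set Implicit Arguments.
Unset Strict Implicit.
Unset Printing Implicit Defensive.

Import Order.TTheory GRing.Theory Num.Theory.
Import numFieldNormedType.Exports.

Local Open Scope classical_set_scope.
Local Open Scope ring_scope.

Section conditional_expectation.
Context d (Omega : measurableType d) (R : realType) (P : probability Omega R).

Definition sub_sigma_algebra (G : set (set Omega)) :=
  sigma_algebra setT G /\ G `<=` measurable.

Definition measurable_wrt (G : set (set Omega)) (X : Omega -> R) :=
  forall B : set R, measurable B -> G (X @^-1` B).

Definition is_condexp (G : set (set Omega)) (X Y : Omega -> R) :=
  [/\ measurable_wrt G Y,
      P.-integrable setT (EFin \o Y) &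
      forall A, G A ->
        (\int[P]_(w in A) (Y w)%:E = \int[P]_(w in A) (X w)%:E)%E].

(* E(X | G) as one version among the a.e. equal ones, selected by choice; a
   version exists as soon as X is integrable, see [condexpP]. *)
Definition condexp (G : set (set Omega)) (X : Omega -> R) : Omega -> R :=
  xget (fun=> 0) [set Y | is_condexp G X Y].

Lemma condexpP (G : set (set Omega)) (X : Omega -> R) :
  sub_sigma_algebra G -> P.-integrable setT (EFin \o X) ->
  is_condexp G X (condexp G X).
Proof.
move=> [sG GA] iX.
suff [Y HY] : exists Y, is_condexp G X Y by exact: (xgetI _ HY).
pose TG := g_sigma_algebraType G.
have mG A : measurable (A : set TG) = G A by rewrite measurable_g_measurableTypeE.
have mid : measurable_fun [set: Omega] (id : Omega -> TG).
  by move=> _ A mA; rewrite setTI; apply: GA; rewrite -mG.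
pose idG : {mfun Omega >-> TG} :=
  HB.pack (id : Omega -> TG) (isMeasurableFun.Build _ _ _ _ _ mid).
pose mu := distribution P idG.
pose nu : {charge set TG -> \bar R} :=
  measure_function_pushforward__canonical__charge_Charge (induced_charge iX) mid.
have numu : nu `<< mu.
  apply/null_content_dominatesP => A mA muA.
  have mA' : measurable (A : set Omega) by apply: GA; rewrite -mG.
  apply: (@null_set_integral _ Omega R P A (EFin \o X) mA' _ muA).
  exact/measurable_funTS/(measurable_int P iX).
pose f := Radon_Nikodym nu mu.
have f_fin w : f w \is a fin_num by exact: Radon_Nikodym_fin_num.
have intf : mu.-integrable setT f by exact: Radon_Nikodym_integrable.
have mf : measurable_fun setT f by exact: measurable_int intf.
have fineK' : EFin \o (fine \o f) = f.
  by apply/funext => w /=; rewrite fineK.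
have intPf : P.-integrable setT (f \o (id : Omega -> TG)).
  apply/integrableP; split; first exact: measurableT_comp.
  move/integrableP : intf => [_].
  by rewrite ge0_integral_pushforward//; exact: measurableT_comp.
exists (fine \o f); split.
- move=> B mB; rewrite -mG -[X in measurable X]setTI.
  have mff : measurable_fun setT (fine \o f) by apply/measurable_EFinP; rewrite fineK'.
  exact: mff.
- by rewrite fineK'.
- move=> A; rewrite -mG => mA.
  transitivity (nu A); last by [].
  rewrite (Radon_Nikodym_integral numu mA) integral_pushforward//.
    by apply: eq_integral => w _ /=; rewrite fineK.
  by apply: (integrableS measurableT) => //; apply: GA; rewrite -mG.
Qed.
End conditional_expectation.

Section stationary_sequences.
Context d (Omega : measurableType d) (R : realType).
Implicit Types (T Ti : Omega -> Omega) (X : int -> Omega -> R).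

(* T^i for i : int, where Ti is the inverse of T. *)
Definition ziter T Ti (i : int) : Omega -> Omega :=
  match i with Posz n => iter n T | Negz n => iter n.+1 Ti end.

(* X_i = X_0 o T^i *)
Definition shift_process T Ti (X0 : Omega -> R) (i : int) : Omega -> R :=
  X0 \o ziter T Ti i.

(* F_i = T^{-i}(F_0) *)
Definition shift_filtration T Ti (F0 : set (set Omega)) (i : int) :
    set (set Omega) :=
  [set ziter T Ti i @^-1` A | A in F0].

Definition bimeasurable_bijection T Ti :=
  [/\ cancel T Ti, cancel Ti T, measurable_fun setT T & measurable_fun setT Ti].

Definition measure_preserving (P : probability Omega R) T :=
  forall A, measurable A -> P (T @^-1` A) = P A.

Record stationary_adapted_Lp (P : probability Omega R) (p : R) T Ti
    (F0 : set (set Omega)) (X0 : Omega -> R) : Prop := {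
  sa_bij : bimeasurable_bijection T Ti;
  sa_preserving : measure_preserving P T;
  sa_sub : sub_sigma_algebra F0;
  sa_nondecreasing : F0 `<=` shift_filtration T Ti F0 1;
  sa_adapted : measurable_wrt F0 X0;
  sa_Lp : X0 \in Lfun P p%:E }.

Definition partial_sum X (n : nat) (w : Omega) : R :=
  \sum_(1 <= j < n.+1) X j%:Z w.

Definition rosenthal_delta (p : R) : R := Num.min 1 (p - 2)^-1.

(* The bracket of the Rosenthal-type inequality, with coefficient c in front of
   the second term; E0 is the conditional expectation with respect to F_0. *)
Definition rosenthal_bracket (P : probability Omega R) (p c : R) X
    (E0 : (Omega -> R) -> Omega -> R) (n : nat) : \bar R :=
  (let S := partial_sum X in
   let delta := rosenthal_delta p in
   n%:R%:E * 'E_P[fun w => `|X 1 w| `^ p]%R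
   + c%:E * n%:R%:E *
     (\sum_(1 <= k < n.+1)
        ((k%:R `^ (1 + p^-1))^-1)%R%:E *
        'N[P]_p%:E[EFin \o E0 (S k)]) `^ p
   + n%:R%:E *
     (\sum_(1 <= k < n.+1)
        ((k%:R `^ (1 + 2 * delta / p))^-1)%R%:E *
        'N[P]_(p / 2)%:E[EFin \o E0 (fun w => S k w ^+ 2)%R] `^ delta)
     `^ (p / (2 * delta)))%E.

End stationary_sequences.

(* Main.v *)
(* Let [A n = E|S_n|^p], [U n = E|E_0 S_n|^p] and [V n = E|E_0 (S_n^2)|^(p/2)].
   Expanding [|x + y|^p] to second order with [x = S_n] and [y = S_(2n) - S_n],
   and conditioning [y] and [y^2] on the past of [x], gives
     [A (2n) <= 2 A n + c (A^(1 - 1/p) U^(1/p) + A^(1 - 2 delta/p) V^(2 delta/p))],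
   where the right-hand side is taken at [n].  Iterated along powers of two,
   this bounds [A (2^r)] by sums of [U] and [V] over dyadic indices, and the
   quasi-subadditivity of [U^(1/p)] and [V^(2 delta/p)] turns these sums into
   the full ones.
     For the maximum [M_N], [N = 2^r], Doob's argument bounds [M_N^p] pathwise
   by a multiple of [\sum_m |S_m| (M_m^(p-1) - M_(m-1)^(p-1))].  In the
   expectation [S_m] is replaced by [S_N] minus the dyadic blocks filling
   [(m, N]], and each block by its conditional expectation given its past, which
   costs [\sum_l (2^(r-l) U (2^l))^(1/p)].  For [p >= 4] this last sum is
   dominated by the one in [V], since [U <= V] and [2 delta <= 1]. *)
Require Import Defs.
From HB Require Import structures.
From mathcomp Require Import all_boot all_order all_algebra.
From mathcomp Require Import all_classical all_reals all_analysis.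
From mathcomp Require Import measurable_realfun.
From mathcomp Require Import ring lra zify.

Set Implicit Arguments.
Unset Strict Implicit.
Unset Printing Implicit Defensive.

Import Order.TTheory GRing.Theory Num.Theory.
Import numFieldNormedType.Exports.

Local Open Scope classical_set_scope.
Local Open Scope ring_scope.

(** * Inequalities for real powers and sequences *)

Section power_inequalities.
Context {R : realType}.
Implicit Types a b x y p r t : R.

(** The exponent [delta] is dictated by the remainder of the expansion. Where [|y| > |x|] this has
    order [|x| |y|^(p-1)] and must be expressed by [F = |y|^p] and [G = |x|^(p-2) y^2], of which the
    second can be conditioned on the past. For [p >= 3] it equals [F^(1-d) G^d] exactly when
    [d (p-2) = 1]; for [p <= 3] it is at most [G].

    The recursion is not linear: the unknown moment occurs on the right with powers below one.
    Dividing by the number of terms removes the factor 2; a bound of the right size is then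
    propagated, and the sublinear terms are absorbed with a constant depending on [p] only.

    Conditional expectations are versions picked by choice, so nothing relates them pointwise.
    Jensen's inequality, the tower property and subadditivity are therefore used in weak form,
    integrated against bounded [F0]-measurable functions; [moment_domination] turns such comparisons
    into comparisons of moments.

    Constants are fixed before the probability space, which is why the analytic inequalities are
    isolated as statements on real numbers and sequences. *)

Lemma le_powR r a b : 0 <= r -> 0 <= a -> a <= b -> a `^ r <= b `^ r.
Proof.
move=> r0 a0 ab; apply: ge0_ler_powR => //; rewrite nnegrE//.
exact: le_trans ab.
Qed.

(** Convexity of the power, as the tangent line at [b]. It is Young's inequality for [a] and
    [b^(r-1)] with exponents [r] and [r / (r - 1)]. *)
Lemma powR_tangent r a b : 1 <= r -> 0 <= a -> 0 <= b ->
  b `^ r + r * b `^ (r - 1) * (a - b) <= a `^ r.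
Proof.
rewrite le_eqVlt => /predU1P[<-|r1] a0 b0.
  by rewrite subrr powRr0 !powRr1//; lra.
have r0 : 0 < r by lra.
have r10 : r - 1 != 0 by lra.
have q0 : 0 < r / (r - 1) by rewrite divr_gt0//; lra.
have := @conjugate_powR R a (b `^ (r - 1)) r (r / (r - 1)) a0 (powR_ge0 _ _) r0 q0.
rewrite -powRrM.
have -> : (r - 1) * (r / (r - 1)) = r by field.
move=> /(_ _)/wrap[]; first by field; rewrite r10 gt_eqF.
have <- := @mulr_powRB1 R b r b0 r0.
have -> : (b * b `^ (r - 1)) / (r / (r - 1)) = b * b `^ (r - 1) * (r - 1) / r.
  by field; rewrite r10 gt_eqF.
set B := b `^ (r - 1) => H.
have : r * (a * B) <= r * (a `^ r / r + b * B * (r - 1) / r) by rewrite ler_pM2l.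
have -> : r * (a `^ r / r + b * B * (r - 1) / r) = a `^ r + b * B * (r - 1).
  by field; rewrite gt_eqF.
lra.
Qed.

(** Weighted arithmetic-geometric mean. The end point [t = 1] matters: it is the value of [delta]
    for [p <= 3]. *)
Lemma powR_young t a b : 0 <= t <= 1 -> 0 <= a -> 0 <= b ->
  a `^ (1 - t) * b `^ t <= (1 - t) * a + t * b.
Proof.
move=> /andP[]; rewrite le_eqVlt => /predU1P[<- _|t0].
  by move=> a0 b0; rewrite subr0 powRr0 powRr1//; lra.
rewrite le_eqVlt => /predU1P[->|t1] a0 b0.
  by rewrite subrr powRr0 powRr1//; lra.
have p0 : 0 < (1 - t)^-1 by rewrite invr_gt0; lra.
have q0 : 0 < t^-1 by rewrite invr_gt0; lra.
have := @conjugate_powR R (a `^ (1 - t)) (b `^ t) _ _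
  (powR_ge0 _ _) (powR_ge0 _ _) p0 q0.
rewrite !invrK -!powRrM !mulfV ?gt_eqF ?subr_gt0// !powRr1// => /(_ _)/wrap[]; lra.
Qed.

Lemma powRD_gt0 x r t : 0 < x -> x `^ (r + t) = x `^ r * x `^ t.
Proof. by move=> x0; rewrite powRD// (gt_eqF x0) implybT. Qed.

Lemma rosenthal_deltaP p : 2 < p ->
  [/\ 0 < rosenthal_delta p, rosenthal_delta p <= 1 &
   (p <= 3 /\ rosenthal_delta p = 1) \/
   (3 <= p /\ rosenthal_delta p * (p - 2) = 1)].
Proof.
move=> p2; rewrite /rosenthal_delta; have p20 : 0 < p - 2 by rewrite subr_gt0.
have [p3|p3] := lerP p 3.
  have H : 1 <= (p - 2)^-1 by rewrite -invr1 lef_pV2 ?posrE//; lra.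
  by rewrite (min_idPl H); split => //; left.
have H : (p - 2)^-1 <= 1 by rewrite -[leRHS]invr1 lef_pV2 ?posrE//; lra.
rewrite (min_idPr H) invr_gt0; split => //; right; split; first exact: ltW.
by rewrite mulVf// gt_eqF.
Qed.

(** The tangent at [x + y], evaluated at [x], gives the linear term with slope [p (x + y)^(p-1)].
    Replacing this slope by [p x^(p-1)] costs the quadratic term, because all points stay in
    [[0, 2x]], where [p - 1 >= 1] makes the slope Lipschitz. *)
Lemma powR_add_le_near p x y : 2 < p -> 0 < x -> `|y| <= x ->
  (x + y) `^ p <= x `^ p + p * x `^ (p - 1) * y
                  + p * (p - 1) * 2 `^ (p - 2) * (x `^ (p - 2) * y ^+ 2).
Proof.
move=> p2 x0 yx; have /andP[yx1 yx2] : - x <= y <= x by rewrite -ler_norml.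
have xy0 : 0 <= x + y by lra.
have T1 := @powR_tangent p x (x + y) ltac:(lra) (ltW x0) xy0.
suff H : ((x + y) `^ (p - 1) - x `^ (p - 1)) * y <=
    (p - 1) * 2 `^ (p - 2) * (x `^ (p - 2) * y ^+ 2).
  have : p * (((x + y) `^ (p - 1) - x `^ (p - 1)) * y) <=
         p * ((p - 1) * 2 `^ (p - 2) * (x `^ (p - 2) * y ^+ 2)).
    by rewrite ler_wpM2l//; lra.
  by move: T1; lra.
have pp : (p - 1) - 1 = p - 2 :> R by ring.
have q1 : 1 <= p - 1 by lra.
have K z w : 0 <= z -> 0 <= w -> w <= 2 * x ->
    w `^ (p - 1) - z `^ (p - 1) <= (p - 1) * 2 `^ (p - 2) * x `^ (p - 2) * `|w - z|.
  move=> z0 w0 wx; have := @powR_tangent (p - 1) z w q1 z0 w0.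
  rewrite pp => T2.
  have B : w `^ (p - 2) <= 2 `^ (p - 2) * x `^ (p - 2).
    by rewrite -powRM// ?(ltW x0)//; apply: le_powR => //; lra.
  have W0 : 0 <= w `^ (p - 2) by exact: powR_ge0.
  have : (p - 1) * w `^ (p - 2) * (w - z) <= (p - 1) * (2 `^ (p - 2) * x `^ (p - 2)) * `|w - z|.
    apply: (@le_trans _ _ ((p - 1) * w `^ (p - 2) * `|w - z|)).
      by rewrite ler_wpM2l ?ler_norm// mulr_ge0//; lra.
    by rewrite ler_wpM2r ?normr_ge0// ler_wpM2l//; lra.
  lra.
have [y0|y0] := leP 0 y.
  have := @K x (x + y) (ltW x0) xy0 ltac:(lra).
  rewrite (_ : x + y - x = y); last by ring.
  rewrite (ger0_norm y0) => /(ler_wpM2r y0); lra.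
have := @K (x + y) x xy0 (ltW x0) ltac:(lra).
rewrite (_ : x - (x + y) = - y); last by ring.
rewrite normrN (ltr0_norm y0) => H.
have /(ler_wpM2r) := H => /(_ (- y))/wrap[]; lra.
Qed.

(* Both regimes of [delta] give the same error term: for [p <= 3] the factor
   [F `^ (1 - delta)] is [1], for [p >= 3] the second summand is
   [`|x| * `|y| `^ (p - 1)]. *)
Lemma powR_norm_add p (d := rosenthal_delta p) : 2 < p ->
  exists2 C : R, 0 <= C & forall x y F G,
    F = `|y| `^ p -> G = `|x| `^ (p - 2) * y ^+ 2 ->
    `|x + y| `^ p <= `|x| `^ p + F + p * (Num.sg x * `|x| `^ (p - 1)) * y
                     + C * (G + F `^ (1 - d) * G `^ d).
Proof.
move=> p2; have [d0 d1 dP] := rosenthal_deltaP p2; rewrite -/d in d0 d1 dP.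
(* The summands serve in turn the expansion for [|y| <= |x|], the growth for [|y| > |x|], and the
   linear term of the bound, which may be negative in the second region. *)
pose C := p * (p - 1) * 2 `^ (p - 2) + p * 2 `^ (p - 1) + p.
have C1 : 0 <= p * (p - 1) * 2 `^ (p - 2).
  by rewrite !mulr_ge0 ?powR_ge0//; lra.
have C2 : 0 <= p * 2 `^ (p - 1) by rewrite mulr_ge0 ?powR_ge0//; lra.
exists C; first by rewrite /C; lra.
move=> x y _ _ -> ->.
set F := `|y| `^ p; set G := _ * y ^+ 2.
have F0 : 0 <= F by exact: powR_ge0.
have G0 : 0 <= G by rewrite mulr_ge0 ?powR_ge0 ?sqr_ge0.
have FG0 : 0 <= F `^ (1 - d) * G `^ d by rewrite mulr_ge0 ?powR_ge0.
have [yx|xy] := leP `|y| `|x|.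
  have [x0|x0|x0] := ltrgtP x 0.
  - have := @powR_add_le_near p (- x) (- y) p2; rewrite oppr_gt0 normrN => /(_ x0).
    rewrite -{1}(ltr0_norm x0) => /(_ yx).
    rewrite -{2 3 4}(ltr0_norm x0) sqrrN -/G => H.
    have -> : `|x + y| = - x + - y.
      by rewrite ler0_norm; [lra|move: yx; rewrite (ltr0_norm x0) ler_norml => /andP[]; lra].
    have CG : C * (G + F `^ (1 - d) * G `^ d) >= p * (p - 1) * 2 `^ (p - 2) * G.
      rewrite /C; set K := p * (p - 1) * _ in C1 *; set K2 := p * _ in C2 *.
      set V := F `^ _ * _ in FG0 *; clearbody K K2 V G; nra.
    by rewrite ltr0_sg//; lra.
  - have := @powR_add_le_near p x y p2 x0.
    rewrite -{1 3 4 5}(gtr0_norm x0) => /(_ yx); rewrite -/G => H.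
    have -> : `|x + y| = x + y.
      by rewrite ger0_norm//; move: yx; rewrite (gtr0_norm x0) ler_norml => /andP[]; lra.
    have CG : C * (G + F `^ (1 - d) * G `^ d) >= p * (p - 1) * 2 `^ (p - 2) * G.
      rewrite /C; set K := p * (p - 1) * _ in C1 *; set K2 := p * _ in C2 *.
      set V := F `^ _ * _ in FG0 *; clearbody K K2 V G; nra.
    by rewrite gtr0_sg//; lra.
  - move: yx; rewrite x0 normr0 normr_le0 => /eqP y0.
    rewrite y0 addr0 normr0 mulr0 powR0; last lra.
    by rewrite !addr0 add0r addr_ge0// mulr_ge0//; [rewrite /C|]; lra.
have y0 : 0 < `|y| by exact: le_lt_trans xy.
have HX : `|x| * `|y| `^ (p - 1) <= G + F `^ (1 - d) * G `^ d.
  have [x0|x0] := eqVneq x 0; first by rewrite x0 normr0 mul0r; lra.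
  have nx0 : 0 < `|x| by rewrite normr_gt0.
  have y2 : y ^+ 2 = `|y| `^ 2 by rewrite -(real_normK (num_real y)) powR_mulrn.
  case: dP => -[p3 dE].
    suff : `|x| * `|y| `^ (p - 1) <= G by lra.
    (* Since [p <= 3], the factor [|x|^(3-p)] may be raised to [|y|^(3-p)]. *)
    have -> : `|x| * `|y| `^ (p - 1) = `|x| `^ (p - 2) * (`|x| `^ (3 - p) * `|y| `^ (p - 1)).
      rewrite mulrA -powRD_gt0//.
      by rewrite (_ : p - 2 + (3 - p) = 1) ?powRr1//; ring.
    rewrite ler_wpM2l ?powR_ge0// y2.
    rewrite (_ : 2 = 3 - p + (p - 1) :> R); last by ring.
    rewrite [leRHS]powRD_gt0//.
    by rewrite ler_wpM2r ?powR_ge0// le_powR// ?(ltW xy)//; lra.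
  suff -> : F `^ (1 - d) * G `^ d = `|x| * `|y| `^ (p - 1) by lra.
  rewrite powRM ?powR_ge0 ?sqr_ge0// y2 /F -!powRrM mulrC -mulrA -powRD_gt0//.
  rewrite (mulrC (p - 2)) dE powRr1//; congr (_ * _ `^ _).
  have -> : 2 * d + p * (1 - d) = p - d * (p - 2) by ring.
  by rewrite dE.
have T : `|x + y| `^ p <= F + p * 2 `^ (p - 1) * (`|x| * `|y| `^ (p - 1)).
  apply: (@le_trans _ _ ((`|x| + `|y|) `^ p)).
    by rewrite le_powR ?ler_normD//; lra.
  have xy0 : 0 <= `|x| + `|y| by rewrite addr_ge0.
  (* Tangent at [|x| + |y|], evaluated at [|y|]; the slope is controlled by [|x| + |y| <= 2 |y|]. *)
  have := @powR_tangent p `|y| (`|x| + `|y|) ltac:(lra) (normr_ge0 _) xy0.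
  have B : (`|x| + `|y|) `^ (p - 1) <= 2 `^ (p - 1) * `|y| `^ (p - 1).
    by rewrite -powRM//; apply: le_powR => //; lra.
  have : p * `|x| * (`|x| + `|y|) `^ (p - 1) <= p * `|x| * (2 `^ (p - 1) * `|y| `^ (p - 1)).
    by rewrite ler_wpM2l// mulr_ge0//; lra.
  rewrite -/F; lra.
have L : - (p * (Num.sg x * `|x| `^ (p - 1)) * y) <= p * (`|x| * `|y| `^ (p - 1)).
  apply: le_trans (ler_norm _) _; rewrite normrN !normrM.
  rewrite (ger0_norm (powR_ge0 _ _)) (@ger0_norm _ p); last lra.
  rewrite -!mulrA ler_wpM2l//; first lra.
  have [->|x0] := eqVneq x 0; first by rewrite sgr0 normr0 !mul0r.
  have nx0 : 0 < `|x| by rewrite normr_gt0.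
  rewrite normr_sg x0 mul1r.
  have -> : `|x| `^ (p - 1) = `|x| * `|x| `^ (p - 2).
    by rewrite -{2}(powRr1 (ltW nx0)) -powRD_gt0//; congr (_ `^ _); ring.
  have -> : `|y| `^ (p - 1) = `|y| `^ (p - 2) * `|y|.
    by rewrite -{3}(powRr1 (ltW y0)) -powRD_gt0//; congr (_ `^ _); ring.
  rewrite -mulrA ler_wpM2l// ler_wpM2r// le_powR// ?(ltW xy)//; lra.
have CH : (p * 2 `^ (p - 1) + p) * (`|x| * `|y| `^ (p - 1)) <= C * (G + F `^ (1 - d) * G `^ d).
  apply: (@le_trans _ _ ((p * 2 `^ (p - 1) + p) * (G + F `^ (1 - d) * G `^ d))).
    by rewrite ler_wpM2l//; lra.
  by rewrite ler_wpM2r//; [lra|rewrite /C; lra].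
have : 0 <= `|x| `^ p by exact: powR_ge0.
lra.
Qed.
End power_inequalities.

(** * Running maxima, dyadic chaining and recursions for real sequences *)

Section numeric_sequences.
Context {R : realType}.
Implicit Types (p t C K : R) (u A e z f : nat -> R).

Lemma powRVK (x t : R) : 0 <= x -> 0 < t -> (x `^ t^-1) `^ t = x.
Proof. by move=> x0 t0; rewrite -powRrM mulVf ?powRr1// gt_eqF. Qed.

Lemma powRD_le (r x y : R) : 0 <= r -> 0 <= x -> 0 <= y ->
  (x + y) `^ r <= 2 `^ r * (x `^ r + y `^ r).
Proof.
move=> r0 x0 y0; have [xy|/ltW yx] := leP x y.
  apply: (@le_trans _ _ ((2 * y) `^ r)); first by apply: le_powR; lra.
  by rewrite powRM// ler_wpM2l ?powR_ge0// lerDr powR_ge0.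
apply: (@le_trans _ _ ((2 * x) `^ r)); first by apply: le_powR; lra.
by rewrite powRM// ler_wpM2l ?powR_ge0// lerDl powR_ge0.
Qed.

(** The index 0 contributes 0 instead of [u 0]. For nonnegative [u] this is the maximum over
    [1 <= j <= n], and sums of increments of its powers telescope down to 0. *)
Fixpoint running_max u n : R :=
  if n is m.+1 then Num.max (running_max u m) (u m.+1) else 0.

Lemma running_max_ge0 u n : 0 <= running_max u n.
Proof. by elim: n => //= n IH; rewrite le_max IH. Qed.

Lemma running_max_le u m n : (0 < m <= n)%N -> u m <= running_max u n.
Proof.
elim: n => [|n IH]; first by case: m.
move=> /andP[m0]; rewrite leq_eqVlt ltnS => /predU1P[->|mn] /=.
  by rewrite le_max lexx orbT.
by rewrite le_max IH ?m0.
Qed.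

Lemma running_maxS u n : running_max u n <= running_max u n.+1.
Proof. by rewrite /= le_max lexx. Qed.

(* Doob's maximal inequality before taking expectations. *)
Lemma running_max_powR_le u n p : 1 < p -> (forall m, 0 <= u m) ->
  running_max u n `^ p <= p / (p - 1) * \sum_(m < n)
    u m.+1 * (running_max u m.+1 `^ (p - 1) - running_max u m `^ (p - 1)).
Proof.
move=> p1 u0; elim: n => [|n IH].
  by rewrite big_ord0 mulr0 powR0//; lra.
rewrite big_ord_recr mulrDr /=.
set M := running_max u n in IH *; have M0 : 0 <= M by exact: running_max_ge0.
have [uM|Mu] := leP (u n.+1) M.
  by rewrite subrr !mulr0 addr0.
set a := u n.+1 in Mu *; have a0 : 0 <= a by exact: u0.
(* At a new record [a] the required inequality rearranges to the tangent at [M] evaluated at [a];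
   without a record neither side changes. *)
have := @powR_tangent R p a M (ltW p1) a0 M0.
suff : p / (p - 1) * (a * (a `^ (p - 1) - M `^ (p - 1))) =
       (p * a `^ p - p * M `^ (p - 1) * a) / (p - 1).
  move=> -> T; apply: le_trans (lerD IH (lexx _)).
  rewrite -lerBlDl ler_pdivlMr ?subr_gt0//.
  have <- := @mulr_powRB1 R M p M0 ltac:(lra).
  have := @mulr_powRB1 R M p M0 ltac:(lra).
  move: T; lra.
have <- := @mulr_powRB1 R a p a0 ltac:(lra).
field; lra.
Qed.

(* Split the interval [(m, 2 ^ r]] into dyadic blocks of distinct sizes, all
   of them to the right of [m]. *)
Lemma dyadic_chaining e z r m : (forall l, 0 <= z l) ->
  (forall l j, (l < r)%N -> (m <= j * 2 ^ l)%N -> (j.+1 * 2 ^ l <= 2 ^ r)%N ->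
     e (j.+1 * 2 ^ l)%N - e (j * 2 ^ l)%N <= z l) ->
  (0 < m <= 2 ^ r)%N -> e (2 ^ r)%N - e m <= \sum_(l < r) z l.
Proof.
move=> z0 H /andP[m0 mr].
(* Bisection: [m] stays in the dyadic interval [(k 2^q, (k+1) 2^q]]. If it falls in the left half,
   the right half is a full block beyond [m] and is paid for by one [z]; otherwise nothing is
   paid. *)
suff G q k : (q <= r)%N -> (k.+1 * 2 ^ q <= 2 ^ r)%N ->
    (k * 2 ^ q < m <= k.+1 * 2 ^ q)%N ->
    e (k.+1 * 2 ^ q)%N - e m <= \sum_(l < q) z l.
  by have := G r 0%N; rewrite mul0n mul1n m0 mr => /(_ (leqnn _) (leqnn _) isT).
elim: q k => [|q IH] k qr kr /andP[km mk].
  rewrite !expn0 !muln1 in km mk.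
  have -> : m = k.+1 by lia.
  by rewrite expn0 muln1 subrr big_ord0.
have E1 : ((2 * k).+2 * 2 ^ q = k.+1 * 2 ^ q.+1)%N by rewrite expnS; lia.
have E2 : (2 * k * 2 ^ q = k * 2 ^ q.+1)%N by rewrite expnS; lia.
rewrite big_ord_recr /=.
have [mh|hm] := leqP m ((2 * k).+1 * 2 ^ q).
  have h1 := IH (2 * k)%N (ltnW qr).
  have h2 := H q (2 * k).+1 qr mh.
  rewrite E1 in h2; move/(_ kr) in h2.
  have := h1 _ _; rewrite E2 km mh => /(_ _ isT)/wrap[]; last lra.
  by apply: leq_trans kr; rewrite -E1 leq_pmul2r ?expn_gt0.
have := IH (2 * k).+1 (ltnW qr); rewrite E1 hm mk => /(_ kr isT).
have := z0 q; lra.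
Qed.

(** The two size conditions say [3 C <= D^t] and [c <= X^t], so [3 C c] completes [(D X)^(1-t)] to
    at most [D X]. The share is one third because three terms have to fit under the same bound in
    [rosenthal_recursion]. *)
Lemma powR_absorb C D X t c : 0 <= C -> 0 <= D -> 0 <= X -> 0 < t <= 1 ->
  0 <= c -> c `^ t^-1 <= X -> (3 * C) `^ t^-1 <= D ->
  C * (D * X) `^ (1 - t) * c <= D * X / 3.
Proof.
move=> C0 D0 X0 /andP[t0 t1] c0 cX CD.
have Dt : 3 * C <= D `^ t.
  rewrite -[leLHS](powRVK _ t0) ?mulr_ge0//.
  by apply: le_powR => //; [exact: ltW|exact: powR_ge0].
have cXt : c <= X `^ t.
  rewrite -[leLHS](powRVK _ t0)//.
  by apply: le_powR => //; [exact: ltW|exact: powR_ge0].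
have B0 : 0 <= D * X by exact: mulr_ge0.
have : (D * X) `^ (1 - t) * (3 * C * c) <= (D * X) `^ (1 - t) * (D * X) `^ t.
  by rewrite (powRM t D0 X0) ler_wpM2l ?powR_ge0// ler_pM// mulr_ge0.
have -> : (D * X) `^ (1 - t) * (D * X) `^ t = D * X.
  have [->|Bn0] := eqVneq (D * X) 0; first by rewrite (@powR0 _ t) ?mulr0// gt_eqF.
  by rewrite -powRD_gt0 ?lt0r ?Bn0// subrK powRr1.
lra.
Qed.

(** A nonlinear Gronwall argument with the a priori bound [B = D X], where [X] is the bracket of the
    conclusion. As long as [A <= B], the powers of [A] may be replaced by those of [B]; then the
    initial value and the two accumulated sums are each at most [B / 3], which restores [A <= B].
    The induction carries both the accumulated form and this bound. *)
Lemma rosenthal_recursion C t1 t2 : 0 <= C -> 0 < t1 <= 1 -> 0 < t2 <= 1 ->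
  exists2 D, 0 <= D & forall A e z r,
    (forall s, 0 <= A s) -> (forall s, 0 <= e s) -> (forall s, 0 <= z s) ->
    (forall s, (s < r)%N ->
       A s.+1 <= A s + C * (A s `^ (1 - t1) * e s + A s `^ (1 - t2) * z s)) ->
    A r <= D * (A 0%N + (\sum_(s < r) e s) `^ t1^-1 + (\sum_(s < r) z s) `^ t2^-1).
Proof.
move=> C0 /andP[t10 t11] /andP[t20 t21].
pose D := 3 + (3 * C) `^ t1^-1 + (3 * C) `^ t2^-1.
have P1 := powR_ge0 (3 * C) t1^-1; have P2 := powR_ge0 (3 * C) t2^-1.
have D3 : 3 <= D by rewrite /D; lra.
exists D; first lra.
move=> A e z r A0 e0 z0 H.
set a := \sum_(s < r) e s; set b := \sum_(s < r) z s.
have a0 : 0 <= a by apply: sumr_ge0.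
have b0 : 0 <= b by apply: sumr_ge0.
set X := A 0%N + _ + _.
have Q1 := powR_ge0 a t1^-1; have Q2 := powR_ge0 b t2^-1.
have X0 : 0 <= X by rewrite /X !addr_ge0.
set B := D * X; have B0 : 0 <= B by rewrite mulr_ge0//; lra.
have key t c : 0 < t <= 1 -> 0 <= c -> c `^ t^-1 <= X -> (3 * C) `^ t^-1 <= D ->
    C * B `^ (1 - t) * c <= B / 3.
  by move=> t01 c0 cX CD; apply: powR_absorb => //; lra.
have K1 : C * B `^ (1 - t1) * a <= B / 3.
  by apply: key; rewrite ?t10 //; rewrite /X /D; [have := A0 0%N; lra|lra].
have K2 : C * B `^ (1 - t2) * b <= B / 3.
  by apply: key; rewrite ?t20 //; rewrite /X /D; [have := A0 0%N; lra|lra].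
have A0B : A 0%N <= B / 3.
  rewrite ler_pdivlMr//; apply: (@le_trans _ _ (X * D)); last by rewrite mulrC.
  by apply: ler_pM => //; rewrite /X; lra.
have part q : (q <= r)%N ->
   A q <= A 0%N + C * B `^ (1 - t1) * (\sum_(s < q) e s)
              + C * B `^ (1 - t2) * (\sum_(s < q) z s) /\ A q <= B.
  elim: q => [_|q IH qr]; first by rewrite !big_ord0 !mulr0 !addr0; split => //; lra.
  have [I1 I2] := IH (ltnW qr).
  suff S : A q.+1 <= A 0%N + C * B `^ (1 - t1) * (\sum_(s < q.+1) e s)
              + C * B `^ (1 - t2) * (\sum_(s < q.+1) z s).
    split => //; apply: (le_trans S).
    have mono f : (forall s, 0 <= f s) -> \sum_(s < q.+1) f s <= \sum_(s < r) f s.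
      move=> f0; rewrite -!(big_mkord xpredT) (@big_cat_nat _ _ _ q.+1 0 r)//=.
      by rewrite lerDl sumr_ge0.
    have : C * B `^ (1 - t1) * (\sum_(s < q.+1) e s) <= C * B `^ (1 - t1) * a.
      by rewrite ler_wpM2l ?mono// mulr_ge0 ?powR_ge0.
    have : C * B `^ (1 - t2) * (\sum_(s < q.+1) z s) <= C * B `^ (1 - t2) * b.
      by rewrite ler_wpM2l ?mono// mulr_ge0 ?powR_ge0.
    lra.
  rewrite !big_ord_recr/=; have := H q qr.
  have : C * (A q `^ (1 - t1) * e q) <= C * B `^ (1 - t1) * e q.
    by rewrite -mulrA ler_wpM2l// ler_wpM2r// le_powR//; lra.
  have : C * (A q `^ (1 - t2) * z q) <= C * B `^ (1 - t2) * z q.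
    by rewrite -mulrA ler_wpM2l// ler_wpM2r// le_powR//; lra.
  lra.
by have [] := part r (leqnn _).
Qed.

(** Superadditivity of the power, or the inclusion of [ell^1] in [ell^t]. With [t = (2 delta)^-1]
    its condition [1 <= t] is where [p >= 4] enters. *)
Lemma sum_powR_le (b : nat -> R) t r : 1 <= t -> (forall s, 0 <= b s) ->
  \sum_(s < r) b s `^ t <= (\sum_(s < r) b s) `^ t.
Proof.
move=> t1 b0; elim: r => [|r IH]; first by rewrite !big_ord0 powR_ge0.
rewrite !big_ord_recr/=; set S := \sum_(i < r) b i in IH *.
have S0 : 0 <= S by exact: sumr_ge0.
apply: (le_trans (lerD IH (lexx _))).
have Sb : 0 <= S + b r by exact: addr_ge0.
rewrite -(@mulr_powRB1 _ (S + b r) t)//; last lra.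
rewrite -(@mulr_powRB1 _ S t)//; last lra.
rewrite -(@mulr_powRB1 _ (b r) t)//; last lra.
rewrite mulrDl lerD// ler_wpM2l// le_powR//; have := b0 r; lra.
Qed.

(* Average [f (2 ^ s.+2) <= K * (f (2 ^ s.+1 + j) + f (2 ^ s.+1 - j))] over
   [j < 2 ^ s]. *)
Lemma dyadic_sum_le K t f r n : 0 <= K -> 0 <= t -> (forall k, 0 <= f k) ->
  (forall i j, f (i + j)%N <= K * (f i + f j)) ->
  (forall s, (s < r)%N -> (2 ^ s <= n)%N) ->
  \sum_(s < r) (2 ^ s)%:R `^ (- t) * f (2 ^ s)%N <=
   (1 + 2 * K + 16 * K * 4 `^ t) * \sum_(1 <= k < n.+1) f k * (k%:R `^ (1 + t))^-1.
Proof.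
move=> K0 t0 f0 fK rn.
pose g k : R := f k * (k%:R `^ (1 + t))^-1.
have g0 k : 0 <= g k by rewrite mulr_ge0// invr_ge0 powR_ge0.
pose T m := \sum_(1 <= k < m) g k.
have Tmono m1 m2 : (m1 <= m2)%N -> T m1 <= T m2.
  move=> mm; rewrite /T; case: m1 mm => [_|m1 mm].
    by rewrite big_geq// sumr_ge0.
  by rewrite (@big_cat_nat _ _ _ m1.+1 1 m2)//= lerDl sumr_ge0.
pose h s : R := (2 ^ s)%:R `^ (- t) * f (2 ^ s)%N.
have t4 : 1 <= 4 `^ t by rewrite -[leLHS](powRr0 4) ler_powR//; lra.
have blk s : h s.+2 <= 8 * K * 4 `^ t * (T (2 ^ s.+2)%N - T (2 ^ s)%N).
  have p2 : (0 < 2 ^ s)%N by rewrite expn_gt0.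
  have -> : T (2 ^ s.+2)%N - T (2 ^ s)%N = \sum_(2 ^ s <= k < 2 ^ s.+2) g k.
    rewrite /T (@big_cat_nat _ _ _ (2 ^ s) 1 (2 ^ s.+2))//=; last first.
      by rewrite leq_exp2l// !leqW.
    by rewrite addrAC subrr add0r.
  set Q := (X in _ <= _ * X).
  have fg k : (2 ^ s <= k < 2 ^ s.+2)%N -> f k <= (2 ^ s.+2)%:R `^ (1 + t) * g k.
    move=> /andP[k1 k2]; have k0 : (0 < k)%N by exact: leq_trans k1.
    rewrite /g mulrCA -[leLHS]mulr1 ler_wpM2l// ler_pdivlMr ?powR_gt0 ?ltr0n//.
    by rewrite mul1r le_powR ?ler_nat ?(ltnW k2)//; lra.
  have sumf : \sum_(2 ^ s <= k < 2 ^ s.+2) f k <= (2 ^ s.+2)%:R `^ (1 + t) * Q.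
    rewrite /Q mulr_sumr big_nat_cond [leRHS]big_nat_cond ler_sum// => k.
    by rewrite andbT; exact: fg.
  have sumj : (2 ^ s)%:R * f (2 ^ s.+2)%N <= 2 * K * \sum_(2 ^ s <= k < 2 ^ s.+2) f k.
    have -> : (2 ^ s)%:R * f (2 ^ s.+2)%N = \sum_(0 <= j < 2 ^ s) f (2 ^ s.+2)%N.
      by rewrite sumr_const_nat subn0 mulr_natl.
    apply: (@le_trans _ _ (\sum_(0 <= j < 2 ^ s)
        (K * (f (j + 2 ^ s.+1)%N + f (2 ^ s.+1 - j)%N)))).
      rewrite big_nat_cond [leRHS]big_nat_cond ler_sum// => j /andP[/andP[_ j2] _].
      have E : (2 ^ s.+2 = (j + 2 ^ s.+1) + (2 ^ s.+1 - j))%N by rewrite !expnS in j2 *; lia.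
      by rewrite [in leLHS]E; exact: fK.
    rewrite -mulr_sumr (mulrC 2) -mulrA ler_wpM2l// big_split/= mulr2n mulrDl !mul1r.
    have inj (a b c : nat) : (a <= c)%N -> \sum_(0 <= j < b) f (j + c)%N
        = \sum_(c <= k < b + c) f k.
      by move=> _; rewrite -{2}(add0n c) big_addn addnK.
    have widen a b c d : (a <= c)%N -> (d <= b)%N ->
        \sum_(c <= k < d) f k <= \sum_(a <= k < b) f k.
      move=> ac db; have [cd|dc] := leqP c d; last by rewrite (big_geq (ltnW dc)) sumr_ge0.
      rewrite (@big_cat_nat _ _ _ c a b)//=; last exact: leq_trans cd db.
      rewrite (@big_cat_nat _ _ _ d c b)//= [leRHS]addrC -addrA lerDl.
      by rewrite addr_ge0// sumr_ge0.
    apply: lerD.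
      by rewrite (inj 0%N)// widen// !expnS; lia.
    (* Reversing the order of summation makes the lower half an ascending window, which starts at
       [(2 ^ s).+1]. *)
    have -> : \sum_(0 <= j < 2 ^ s) f (2 ^ s.+1 - j)%N
            = \sum_(0 <= j < 2 ^ s) f (j + (2 ^ s).+1)%N.
      rewrite big_nat_rev /=; apply: eq_big_nat => j /andP[_ j2].
      by congr f; rewrite expnS; lia.
    by rewrite (inj 0%N)// widen// !expnS; lia.
  have N0 : 0 < (2 ^ s.+2)%:R :> R by rewrite ltr0n expn_gt0.
  have h2 : h s.+2 * (2 ^ s.+2)%:R `^ (1 + t) = (2 ^ s.+2)%:R * f (2 ^ s.+2)%N.
    rewrite /h mulrAC -powRD_gt0// (_ : - t + (1 + t) = 1) ?powRr1 ?ltW//; ring.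
  have N4 : (2 ^ s.+2)%:R = 4 * (2 ^ s)%:R :> R by rewrite !expnS -natrM mulnA.
  have P0 : 0 < (2 ^ s.+2)%:R `^ (1 + t) :> R by exact: powR_gt0.
  have Q0 : 0 <= Q by exact: sumr_ge0.
  have : h s.+2 * (2 ^ s.+2)%:R `^ (1 + t) <= (8 * K * Q) * (2 ^ s.+2)%:R `^ (1 + t).
    rewrite h2; move: sumf; set P := _ `^ (1 + t) => sumf; rewrite N4.
    have := ler_wpM2l (ler0n R 4) sumj.
    have := ler_wpM2l (mulr_ge0 (ler0n R 8) K0) sumf.
    lra.
  rewrite ler_pM2r// => hQ; apply: (le_trans hQ).
  by rewrite ler_wpM2r// -[leLHS]mulr1 ler_wpM2l// mulr_ge0.
pose c := 8 * K * 4 `^ t; have c0 : 0 <= c by rewrite !mulr_ge0 ?powR_ge0.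
(* The windows [[2^s, 2^(s+2))] cover each index at most twice, so two terms survive the
   telescoping; this doubles [c] into [16 K 4^t]. *)
have tele m : \sum_(s < m) h s.+2 <= c * (T (2 ^ m.+1)%N + T (2 ^ m)%N).
  elim: m => [|m IH].
    by rewrite big_ord0 mulr_ge0// addr_ge0 ?sumr_ge0.
  rewrite big_ord_recr/=; have := blk m; rewrite -/c; move: IH; lra.
have T2 : 0 <= T n.+1 by exact: sumr_ge0.
have Tn m : (m <= n)%N -> T m.+1 <= T n.+1 by move=> ?; exact: Tmono.
rewrite -/(T n.+1).
(* The scales 1 and 2 are not covered by the window estimate. They are bounded through [f 1], whence
   [1 + 2 K]. *)
have h0E : h 0%N = f 1%N by rewrite /h expn0 powR1 mul1r.
have f1 : (0 < n)%N -> f 1%N <= T n.+1.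
  move=> n0; apply: le_trans (Tn 1%N n0).
  by rewrite /T big_nat1 /g powR1 invr1 mulr1.
have h1E : h 1%N <= 2 * K * f 1%N.
  rewrite /h expn1 (_ : 2 * K * f 1%N = 1 * (K * (f 1%N + f 1%N))); last ring.
  apply: ler_pM; rewrite ?powR_ge0//; last exact: (fK 1%N 1%N).
  by rewrite powRN invf_le1 ?powR_gt0// -[leLHS](powRr0 2) ler_powR//; lra.
have KT : 0 <= K * T n.+1 by exact: mulr_ge0.
have KT4 : 0 <= c * T n.+1 by exact: mulr_ge0.
have -> : 16 * K * 4 `^ t = 2 * c by rewrite /c; ring.
case: r rn => [|[|r]] rn.
- by rewrite big_ord0 mulr_ge0//; lra.
- rewrite big_ord_recr big_ord0 /= add0r -/(h 0%N) h0E.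
  have := f1 (rn 0%N isT); lra.
rewrite !big_ord_recl /= -/(h 0%N) h0E.
have n0 : (0 < n)%N by exact: (rn 0%N isT).
under eq_bigr do rewrite /bump /=.
rewrite -[X in _ + (X + _)]/(h 1%N) -[X in _ + (_ + X)]/(\sum_(s < r) h s.+2).
have F1 := f1 n0.
have KF : K * f 1%N <= K * T n.+1 by rewrite ler_wpM2l.
have B1 : T (2 ^ r.+1)%N <= T n.+1 by apply: Tmono; exact/ltnW/(rn r.+1).
have B2 : T (2 ^ r)%N <= T n.+1.
  by apply: Tmono; apply/ltnW; apply: (rn r); exact: leqW.
have := tele r.
have : c * (T (2 ^ r.+1)%N + T (2 ^ r)%N) <= c * (T n.+1 + T n.+1).
  by rewrite ler_wpM2l// lerD.
lra.
Qed.
End numeric_sequences.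

(** * Moments and conditional expectations *)

Section real_integrals.
Context d (Omega : measurableType d) (R : realType) (P : probability Omega R).
Implicit Types (f g h F G : Omega -> R) (t r : R).
Local Notation intg f := (P.-integrable setT (EFin \o f)).
Local Notation mfun f := (measurable_fun setT f).

Lemma measurable_intg f : intg f -> mfun f.
Proof. by move=> /measurable_int /measurable_EFinP. Qed.

Lemma integrable_dominated f g : mfun f -> (forall w, `|f w| <= g w) ->
  intg g -> intg f.
Proof.
move=> mf fg; apply: le_integrable => //; first exact/measurable_EFinP.
by move=> w _ /=; rewrite lee_fin (le_trans (fg w))// ler_norm.
Qed.

Lemma intgD f g : intg f -> intg g -> intg (fun w => f w + g w).
Proof. by move=> /integrableD /[apply]; exact. Qed.

Lemma intgB f g : intg f -> intg g -> intg (fun w => f w - g w).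
Proof. by move=> /integrableB /[apply]; exact. Qed.

Lemma intgZ (c : R) f : intg f -> intg (fun w => c * f w).
Proof. by move=> /integrableZl; exact. Qed.

Lemma intg_sum (I : Type) (s : seq I) (Q : pred I) (f : I -> Omega -> R) :
  (forall i, Q i -> intg (f i)) -> intg (fun w => \sum_(i <- s | Q i) f i w).
Proof.
move=> H; have := integrable_sum measurableT s H.
apply: eq_integrable => // w _ /=.
by rewrite sumEFin.
Qed.

Lemma Rintegral_sum (I : Type) (s : seq I) (f : I -> Omega -> R) :
  (forall i, intg (f i)) ->
  \int[P]_w (\sum_(i <- s) f i w) = \sum_(i <- s) \int[P]_w f i w.
Proof.
move=> H; elim: s => [|i s IH].
  by under eq_Rintegral do rewrite big_nil; rewrite big_nil Rintegral_cst// mul0r.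
under eq_Rintegral do rewrite big_cons.
rewrite big_cons RintegralD ?IH//; exact: intg_sum.
Qed.

Lemma measurable_norm_powR f r : mfun f -> mfun (fun w => `|f w| `^ r).
Proof.
move=> mf; apply: (measurableT_comp (measurable_powR r)).
exact: measurableT_comp.
Qed.

Lemma intg_interp F G t : (forall w, 0 <= F w) -> (forall w, 0 <= G w) ->
  0 <= t <= 1 -> intg F -> intg G -> intg (fun w => F w `^ (1 - t) * G w `^ t).
Proof.
move=> F0 G0 t01 iF iG.
apply: (@integrable_dominated _ (fun w => (1 - t) * F w + t * G w)).
- apply: measurable_funM; apply: (measurableT_comp (measurable_powR _));
  exact: measurable_intg.
- by move=> w; rewrite ger0_norm ?mulr_ge0 ?powR_ge0//; exact: powR_young.
- by apply: intgD; exact: intgZ.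
Qed.

(** Hölder's inequality with exponents [(1 - t)^-1] and [t^-1]. At the end points one exponent is
    infinite, and the claim is an equality checked by hand. *)
Lemma Rintegral_interp F G t : (forall w, 0 <= F w) -> (forall w, 0 <= G w) ->
  0 <= t <= 1 -> intg F -> intg G ->
  \int[P]_w (F w `^ (1 - t) * G w `^ t) <=
  (\int[P]_w F w) `^ (1 - t) * (\int[P]_w G w) `^ t.
Proof.
move=> F0 G0 t01 iF iG; have iFG := intg_interp F0 G0 t01 iF iG.
have [/andP[t0 t1]|] := boolP (0 < t < 1); last first.
  rewrite negb_and -!leNgt => /orP[t0|t1].
    have -> : t = 0 by move/andP: t01; lra.
    rewrite subr0 powRr0 mulr1 powRr1 ?Rintegral_ge0//.
    by rewrite (@eq_Rintegral _ _ _ _ _ F)// => w _; rewrite powRr0 mulr1 powRr1.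
  have -> : t = 1 by move/andP: t01; lra.
  rewrite subrr powRr0 mul1r powRr1 ?Rintegral_ge0//.
  by rewrite (@eq_Rintegral _ _ _ _ _ G)// => w _; rewrite powRr0 mul1r powRr1.
have p0 : 0 < (1 - t)^-1 by rewrite invr_gt0; lra.
have q0 : 0 < t^-1 by rewrite invr_gt0; lra.
have mF : mfun (fun w => F w `^ (1 - t)).
  by apply: (measurableT_comp (measurable_powR _)); exact: measurable_intg.
have mG : mfun (fun w => G w `^ t).
  by apply: (measurableT_comp (measurable_powR _)); exact: measurable_intg.
have := hoelder P mF mG p0 q0; rewrite !invrK subrK => /(_ erefl).
have NE (H : Omega -> R) (s : R) : (forall w, 0 <= H w) -> 0 < s -> intg H ->
    ('N[P]_(s^-1)%:E[EFin \o (fun w => (H w `^ s)%R)])%E = ((\int[P]_w H w)%R `^ s)%:E.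
  move=> H0 s0 iH; rewrite unlock invrK -poweR_EFin fineK ?integrable_fin_num//.
  congr (_ `^ _)%E; apply: eq_integral => w _ /=.
  by rewrite ger0_norm ?powR_ge0// -powRrM mulfV ?gt_eqF// powRr1.
rewrite !NE//; last lra.
rewrite Lnorm1 -EFinM => H.
rewrite -lee_fin fineK ?integrable_fin_num//.
rewrite (le_trans _ H)//; apply: ge0_le_integral => //=.
- by move=> w _; rewrite lee_fin mulr_ge0// powR_ge0.
- by apply: measurable_int iFG.
- by do 2 apply: measurableT_comp => //; exact: measurable_intg iFG.
- by move=> w _; rewrite lee_fin ler_norm.
Qed.

Lemma intg_of_powR (f : Omega -> R) r : 1 <= r -> mfun f ->
  intg (fun w => `|f w| `^ r) -> intg f.
Proof.
move=> r1 mf iF; have i1 : intg (fun _ => 1) by exact: finite_measure_integrable_cst.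
apply: (integrable_dominated _ _ (intgD i1 iF)) => // w.
have [fw|/ltW fw] := leP 1 `|f w|.
  by rewrite (le_trans (le1r_powR fw r1))// lerDr.
by rewrite (le_trans fw)// lerDl powR_ge0.
Qed.

Lemma measurable_sg (f : Omega -> R) : mfun f -> mfun (fun w => Num.sg (f w)).
Proof.
move=> mf; apply: (measurableT_comp (f := @Num.sg R)) => //.
have -> : @Num.sg R = (fun x => \1_(`]0, +oo[%classic) x - \1_(`]-oo, 0[%classic) x).
  apply/funext => x; rewrite !indicE !mem_setE !in_itv/= andbT.
  by case: sgrP => _; rewrite ?subrr ?subr0 ?sub0r.
by apply: measurable_funB; apply: measurable_indic; exact: measurable_itv.
Qed.
End real_integrals.

(* Comparison of moments from a comparison of first moments against functions
   of the smaller variable: test with [x `^ (r - 1)] truncated and integrate the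
   tangent inequality [powR_tangent]. *)
Lemma moment_domination d (Omega : measurableType d) (R : realType)
    (P : probability Omega R) (r : R) (Y W : Omega -> R) :
  1 <= r -> measurable_fun setT Y -> measurable_fun setT W ->
  (forall w, 0 <= Y w) -> (forall w, 0 <= W w) ->
  P.-integrable setT (EFin \o (fun w => W w `^ r)) ->
  (forall (phi : R -> R) (B : R), measurable_fun setT phi ->
     (forall x, 0 <= phi x <= B) -> (forall x, B < x -> phi x = 0) ->
     \int[P]_w (phi (Y w) * Y w) <= \int[P]_w (phi (Y w) * W w)) ->
  P.-integrable setT (EFin \o (fun w => Y w `^ r)) /\
  \int[P]_w (Y w `^ r) <= \int[P]_w (W w `^ r).
Proof.
move=> r1 mY mW Y0 W0 iW H.
pose ind (n : nat) (x : R) : R := \1_(`[0, n%:R]%classic) x.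
have indE n x : ind n x = (0 <= x <= n%:R)%R%:R.
  by rewrite /ind indicE mem_setE in_itv.
have mind n : measurable_fun setT (ind n).
  by apply: measurable_indic; exact: measurable_itv.
have mind' n : measurable_fun setT (fun w => ind n (Y w)) by exact: measurableT_comp.
have mYr t : measurable_fun setT (fun w => Y w `^ t).
  exact: (measurableT_comp (measurable_powR _)).
have ind01 n x : 0 <= ind n x <= 1 by rewrite indE; case: (0 <= x <= n%:R)%R; rewrite ?lexx ?ler01.
have indY n w t : 0 <= t -> ind n (Y w) * Y w `^ t <= n%:R `^ t.
  move=> t0; rewrite indE Y0/=; case: (leP (Y w) n%:R) => Yn; last by rewrite mul0r powR_ge0.
  by rewrite mul1r le_powR.
have cint (c : R) : P.-integrable setT (EFin \o (fun _ : Omega => c)).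
  exact: finite_measure_integrable_cst.
have iYr n t : 0 <= t -> P.-integrable setT (EFin \o (fun w => ind n (Y w) * Y w `^ t)).
  move=> t0; apply: (integrable_dominated _ _ (cint (n%:R `^ t))).
    exact: measurable_funM.
  by move=> w; rewrite ger0_norm ?indY// mulr_ge0 ?powR_ge0.
have iW1 : P.-integrable setT (EFin \o W).
  by apply: (intg_of_powR r1) => //; under eq_fun do rewrite ger0_norm//.
have le_n n : \int[P]_w (ind n (Y w) * Y w `^ r) <= \int[P]_w (W w `^ r).
  pose phi x := ind n x * x `^ (r - 1).
  have mphi : measurable_fun setT phi.
    by apply: measurable_funM => //; exact: measurable_powR.
  (* One number has to bound the values, hence [n^(r-1)], and mark the point beyond which [phi]
     vanishes, hence [n]. *)
  have phi0 x : 0 <= phi x <= Num.max n%:R (n%:R `^ (r - 1)).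
    rewrite /phi indE; case: (boolP (0 <= x <= n%:R)%R) => [/andP[x0 xn]|_]; last first.
      by rewrite mul0r lexx le_max ler0n.
    rewrite mul1r powR_ge0/= le_max; apply/orP; right; apply: le_powR => //; lra.
  have phiB x : Num.max n%:R (n%:R `^ (r - 1)) < x -> phi x = 0.
    rewrite gt_max => /andP[nx _].
    by rewrite /phi indE [x <= _]leNgt nx andbF mul0r.
  have := H phi _ mphi phi0 phiB.
  have phiYE w : phi (Y w) * Y w = ind n (Y w) * Y w `^ r.
    by rewrite /phi -mulrA (mulrC (_ `^ _)) mulr_powRB1//; lra.
  have iphiW : P.-integrable setT (EFin \o (fun w => phi (Y w) * W w)).
    apply: (integrable_dominated _ _ (intgZ (n%:R `^ (r - 1)) iW1)).
      by apply: measurable_funM => //; exact: measurableT_comp.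
    move=> w; rewrite ger0_norm; last by rewrite mulr_ge0//; have /andP[] := phi0 (Y w).
    by rewrite ler_wpM2r// /phi indY//; lra.
  under eq_Rintegral do rewrite phiYE.
  move=> HH.
  have iYn := iYr n r ltac:(lra).
  (* This integrates the tangent at [Y] evaluated at [W]. The hypothesis bounds [r ind Y^r] on the
     right by the term [r phi(Y) W] on the left; the truncation makes these integrals finite, so
     they cancel. *)
  have : \int[P]_w (ind n (Y w) * Y w `^ r + r * (phi (Y w) * W w)) <=
         \int[P]_w (W w `^ r + r * (ind n (Y w) * Y w `^ r)).
    apply: le_Rintegral => //; [exact/intgD/intgZ|exact/intgD/intgZ|].
    move=> w _; rewrite -phiYE /phi.
    have /andP[i0 i1] := ind01 n (Y w).
    have := powR_tangent r1 (W0 w) (Y0 w) => T.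
    have W' := powR_ge0 (W w) r.
    have -> : ind n (Y w) * Y w `^ (r - 1) * Y w = ind n (Y w) * Y w `^ r.
      by rewrite -phiYE.
    have -> : Y w `^ r = Y w `^ (r - 1) * Y w by rewrite mulrC mulr_powRB1//; lra.
    have YY : Y w `^ r = Y w `^ (r - 1) * Y w by rewrite mulrC mulr_powRB1//; lra.
    rewrite YY in T.
    have := ler_wpM2l i0 T.
    have : ind n (Y w) * W w `^ r <= 1 * W w `^ r by rewrite ler_wpM2r.
    lra.
  rewrite !RintegralD//; try exact: intgZ.
  rewrite !RintegralZl//.
  have : r * \int[P]_w (ind n (Y w) * Y w `^ r) <= r * \int[P]_w (phi (Y w) * W w).
    by rewrite ler_wpM2l//; lra.
  lra.
suff L : (\int[P]_w (Y w `^ r)%:E <= (\int[P]_w (W w `^ r))%R%:E)%E.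
  have iY : P.-integrable setT (EFin \o (fun w => Y w `^ r)).
    apply/integrableP; split; first exact/measurable_EFinP.
    under eq_integral do rewrite /= ger0_norm ?powR_ge0//.
    exact: le_lt_trans L (ltry _).
  by split => //; rewrite -lee_fin fineK ?integrable_fin_num//.
have := @cvg_monotone_convergence _ _ _ P setT measurableT
  (fun n w => (ind n (Y w) * Y w `^ r)%:E).
move=> /(_ _ _ _)/wrap[].
- by move=> n; apply/measurable_EFinP; exact: measurable_funM.
- by move=> n w _; rewrite lee_fin mulr_ge0 ?powR_ge0.
- move=> w _ m n mn; rewrite lee_fin ler_wpM2r ?powR_ge0// !indE Y0/=.
  rewrite ler_nat; case: (leP (Y w) m%:R) => //= Ym.
  by rewrite (le_trans Ym)// ler_nat.
have -> : (\int[P]_w limn (fun n => (ind n (Y w) * Y w `^ r)%:E))%E = (\int[P]_w (Y w `^ r)%:E)%E.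
  apply: eq_integral => w _; apply/cvg_lim => //.
  apply: cvg_near_cst.
  exists (Num.trunc (Y w)).+1 => // n /= Yn.
  rewrite indE Y0/= (_ : Y w <= n%:R) ?mul1r//.
  by rewrite (le_trans (ltW (truncnS_gt _)))// ler_nat.
move=> cv; rewrite -(cvg_lim _ cv)//; apply: lime_le; first by apply/cvg_ex; eexists; exact: cv.
apply: nearW => n; rewrite -[leLHS]fineK; first by rewrite lee_fin; exact: le_n.
by apply: integrable_fin_num => //; apply: iYr; lra.
Qed.

(** * Taking a measurable factor out of a conditional expectation *)

Section pull_out.
Import HBSimple HBNNSimple.
Context d (Omega : measurableType d) (R : realType) (P : probability Omega R).
Variables (G : set (set Omega)) (Z Y : Omega -> R).
Hypotheses (sG : Defs.sub_sigma_algebra G) (iZ : P.-integrable setT (EFin \o Z))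
  (ZY : is_condexp P G Z Y).
(** The same carrier with [G] as its measurable sets: [G]-measurability becomes [measurable_fun],
    and approximation by simple functions yields [G]-measurable ones. *)
Let TG := g_sigma_algebraType G.
Local Notation intg f := (P.-integrable setT (EFin \o f)).
Local Notation mfun f := (measurable_fun setT f).

Lemma g_measurableE (A : set Omega) : measurable (A : set TG) = G A.
Proof. by case: sG => sgG _; rewrite measurable_g_measurableTypeE. Qed.

Lemma g_measurable_fun d' (T' : measurableType d') (h : Omega -> T') :
  measurable_fun [set: TG] h -> mfun h.
Proof.
move=> mh _ B mB; rewrite setTI; case: sG => _; apply.
by rewrite -g_measurableE -[X in measurable X]setTI; exact: mh.
Qed.

Lemma measurable_wrtP (h : Omega -> R) :
  measurable_wrt G h <-> measurable_fun [set: TG] h.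
Proof.
split=> [mh _ B mB|mh B mB].
  by rewrite setTI g_measurableE; exact: mh.
by rewrite -g_measurableE -[X in measurable X]setTI; exact: mh.
Qed.

Let Rintegral_indicM (A : set Omega) (X : Omega -> R) :
  \int[P]_w (\1_A w * X w) = \int[P]_(w in A) X w.
Proof.
rewrite [RHS]Rintegral_mkcond; apply: eq_Rintegral => w _.
by rewrite patchE indicE; case: (w \in A); rewrite ?mul1r ?mul0r.
Qed.

Lemma pull_out_nnsfun (g : {nnsfun TG >-> R}) :
  \int[P]_w (g w * Z w) = \int[P]_w (g w * Y w).
Proof.
have [_ iY condY] := ZY.
have gE w : g w = \sum_(y <- finmap.enum_fset (fset_set (range g)))
                     y * \1_(g @^-1` [set y]) w.
  by rewrite {1}(fimfunE g) fsbig_finite.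
have mA y : G (g @^-1` [set y]).
  by rewrite -g_measurableE -[X in measurable X]setTI; exact: (measurable_funP g).
have E (X : Omega -> R) : intg X -> \int[P]_w (g w * X w) =
    \sum_(y <- finmap.enum_fset (fset_set (range g)))
      y * \int[P]_(w in g @^-1` [set y]) X w.
  move=> iX; have iAX y : intg (fun w => \1_(g @^-1` [set y]) w * X w).
    apply: (@integrable_dominated _ _ _ _ _ (fun w => `|X w|)).
    - apply: measurable_funM; last exact: measurable_intg iX.
      by apply: measurable_indic; apply: (proj2 sG).
    - by move=> w; rewrite indicE; case: (_ \in _); rewrite ?mul1r ?mul0r ?normr0.
    - exact: integrable_norm.
  under eq_Rintegral do rewrite gE mulr_suml.
  rewrite Rintegral_sum; last by move=> y; under eq_fun do rewrite -mulrA; exact: intgZ.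
  apply: eq_bigr => y _; under eq_Rintegral do rewrite -mulrA.
  by rewrite RintegralZl// Rintegral_indicM.
rewrite !E//; apply: eq_bigr => y _; congr (_ * _).
by rewrite /Rintegral condY.
Qed.

(** The factor [h] may be unbounded. Simple functions increase to it, and the assumed integrable
    products [h Z] and [h Y] dominate the two limits. *)
Lemma ge0_pull_out (h : Omega -> R) : (forall w, 0 <= h w) ->
  measurable_fun [set: TG] h ->
  intg (fun w => h w * Z w) -> intg (fun w => h w * Y w) ->
  \int[P]_w (h w * Z w) = \int[P]_w (h w * Y w).
Proof.
move=> h0 mh ihZ ihY; have [_ iY condY] := ZY.
have mhE : measurable_fun [set: TG] (EFin \o h) by exact/measurable_EFinP.
pose g n := nnsfun_approx measurableT mhE n.
have gh n w : 0 <= g n w <= h w.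
  apply/andP; split; first exact: fun_ge0.
  by rewrite -lee_fin /g nnsfun_approxE; apply: le_approx => // x _; rewrite /= lee_fin.
have cvg_g X : intg X -> intg (fun w => h w * X w) ->
    (\int[P]_w (g n w * X w)%:E)%E @[n --> \oo] --> (\int[P]_w (h w * X w)%:E)%E.
  move=> iX ihX.
  have [| | | | |_ _ //] := @dominated_convergence _ _ _ P setT measurableT
    (fun n w => (g n w * X w)%:E) (fun w => (h w * X w)%:E) (fun w => `|h w * X w|%:E).
  - move=> n; apply/measurable_EFinP; apply: measurable_funM; last exact: measurable_intg iX.
    exact/g_measurable_fun/measurable_funP.
  - exact: measurable_int ihX.
  - apply: aeW => w _; apply: cvg_EFin; first exact: nearW.
    apply: cvgMl.
    have hE0 (x : TG) : [set: TG] x -> (0 <= (EFin \o h) x)%E by rewrite lee_fin.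
    have := @cvg_nnsfun_approx _ TG R setT measurableT _ mhE hE0 w Logic.I.
    by move=> /fine_cvgP[].
  - exact: integrable_norm ihX.
  - apply: aeW => w n _; rewrite lee_fin !normrM ler_wpM2r//.
    by have /andP[g0 gle] := gh n w; rewrite !ger0_norm.
have cZ := cvg_g Z iZ ihZ; have cY := cvg_g Y iY ihY.
rewrite /Rintegral -(cvg_lim _ cZ)// -(cvg_lim _ cY)//; congr (fine (limn _)).
apply/funext => n.
have igX X : intg X -> intg (fun w => h w * X w) -> intg (fun w => g n w * X w).
  move=> iX ihX; apply: (integrable_dominated _ _ (integrable_norm ihX)).
    apply: measurable_funM; last exact: measurable_intg iX.
    exact/g_measurable_fun/measurable_funP.
  move=> w; rewrite /= !normrM ler_wpM2r//.
  by have /andP[g0 gle] := gh n w; rewrite !ger0_norm.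
rewrite -[LHS]fineK; last by apply: integrable_fin_num => //; exact: igX.
rewrite -[RHS]fineK; last by apply: integrable_fin_num => //; exact: igX.
by congr EFin; exact: pull_out_nnsfun.
Qed.

Lemma pull_out (h : Omega -> R) : measurable_fun [set: TG] h ->
  intg (fun w => h w * Z w) -> intg (fun w => h w * Y w) ->
  \int[P]_w (h w * Z w) = \int[P]_w (h w * Y w).
Proof.
move=> mh ihZ ihY; have [_ iY condY] := ZY.
pose hp w := Num.max (h w) 0; pose hn w := Num.max (- h w) 0.
have hE w : h w = hp w - hn w.
  by rewrite /hp /hn; case: (leP 0 (h w)) => h0; case: leP; lra.
have hp0 w : 0 <= hp w by rewrite le_max lexx orbT.
have hn0 w : 0 <= hn w by rewrite le_max lexx orbT.
have mhp : measurable_fun [set: TG] hp by exact: measurable_maxr.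
have mhn : measurable_fun [set: TG] hn.
  by apply: measurable_maxr => //; exact: measurableT_comp.
have hph w : `|hp w| <= `|h w|.
  by rewrite ger0_norm// ge_max normr_ge0 ler_norm.
have hnh w : `|hn w| <= `|h w|.
  by rewrite ger0_norm// ge_max normr_ge0 -normrN ler_norm.
have ik (k X : Omega -> R) : measurable_fun [set: TG] k -> (forall w, `|k w| <= `|h w|) ->
    intg X -> intg (fun w => h w * X w) -> intg (fun w => k w * X w).
  move=> mk kh iX ihX; apply: (integrable_dominated _ _ (integrable_norm ihX)).
    apply: measurable_funM; last exact: measurable_intg iX.
    exact: g_measurable_fun.
  by move=> w; rewrite /= !normrM ler_wpM2r.
have E X : intg X -> intg (fun w => h w * X w) -> \int[P]_w (h w * X w) =
    \int[P]_w (hp w * X w) - \int[P]_w (hn w * X w).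
  move=> iX ihX; rewrite -RintegralB//; [|exact: ik|exact: ik].
  by apply: eq_Rintegral => w _; rewrite hE mulrBl.
rewrite !E//; congr (_ - _); apply: ge0_pull_out => //; exact: ik.
Qed.
End pull_out.

(** * Stationary sequences *)

Section measure_preserving_maps.
Context d (Omega : measurableType d) (R : realType) (P : probability Omega R).
Variable phi : Omega -> Omega.
Hypotheses (mphi : measurable_fun setT phi) (phiP : measure_preserving P phi).
Implicit Types f : Omega -> R.

Let ge0_integral_comp (f : Omega -> \bar R) : measurable_fun setT f ->
  (forall w, 0 <= f w)%E -> (\int[P]_w f (phi w) = \int[P]_w f w)%E.
Proof.
move=> mf f0.
have := @ge0_integral_pushforward _ _ _ _ R phi mphi P setT f measurableT mf (fun w _ => f0 w).
rewrite preimage_setT /= => <-.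
by apply: eq_measure_integral => A mA _; exact: phiP.
Qed.

Lemma integrable_comp f : P.-integrable setT (EFin \o f) ->
  P.-integrable setT (EFin \o (fun w => f (phi w))).
Proof.
move=> /integrableP[/measurable_EFinP mf foo]; apply/integrableP; split.
  by apply/measurable_EFinP; exact: measurableT_comp.
by rewrite (ge0_integral_comp (f := fun w => `|(f w)%:E|%E))//; do 2 apply: measurableT_comp => //.
Qed.

Lemma Rintegral_comp f : P.-integrable setT (EFin \o f) ->
  \int[P]_w f (phi w) = \int[P]_w f w.
Proof.
move=> iF; rewrite /Rintegral; congr fine.
have := @integral_pushforward _ _ _ _ R phi mphi P setT (EFin \o f) (measurable_int _ iF).
rewrite preimage_setT => /(_ (integrable_comp iF) measurableT) /= <-.
by apply: eq_measure_integral => A mA _; exact: phiP.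
Qed.
End measure_preserving_maps.

Section stationary.
Context d (Omega : measurableType d) (R : realType) (P : probability Omega R).
Variables (p : R) (T Ti : Omega -> Omega) (F0 : set (set Omega)) (X0 : Omega -> R).
Hypotheses (H : stationary_adapted_Lp P p T Ti F0 X0) (p2 : 2 < p).
Local Notation intg f := (P.-integrable setT (EFin \o f)).
Local Notation mfun f := (measurable_fun setT f).
Let TG := g_sigma_algebraType F0.
Local Notation mfun0 f := (measurable_fun [set: TG] f).
Local Notation S := (partial_sum (shift_process T Ti X0)).

Let TK : cancel T Ti. Proof. by case: (sa_bij H). Qed.
Let TiK : cancel Ti T. Proof. by case: (sa_bij H). Qed.
Let mT : mfun T. Proof. by case: (sa_bij H). Qed.
Let mTi : mfun Ti. Proof. by case: (sa_bij H). Qed.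
Let sF : Defs.sub_sigma_algebra F0. Proof. exact: sa_sub H. Qed.

Lemma iterTK k : cancel (iter k T) (iter k Ti).
Proof. by elim: k => // k IH w; rewrite iterSr /= TK IH. Qed.

Lemma iterTiK k : cancel (iter k Ti) (iter k T).
Proof. by elim: k => // k IH w; rewrite iterSr /= TiK IH. Qed.

Lemma measurable_iterT k : mfun (iter k T).
Proof. by elim: k => [|k IH]; [exact: measurable_id|exact: measurableT_comp]. Qed.

Lemma measurable_iterTi k : mfun (iter k Ti).
Proof. by elim: k => [|k IH]; [exact: measurable_id|exact: measurableT_comp]. Qed.

Lemma iterT_preserving k : measure_preserving P (iter k T).
Proof.
elim: k => [|k IH] A mA //.
rewrite -[RHS](sa_preserving H)// -(IH (T @^-1` A))//.
by rewrite -[X in measurable X]setTI; exact: mT.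
Qed.

Lemma iterTi_preserving k : measure_preserving P (iter k Ti).
Proof.
move=> A mA; rewrite -(iterT_preserving k).
  by congr (P _); apply/seteqP; split => w /=; rewrite iterTK.
by rewrite -[X in measurable X]setTI; exact: measurable_iterTi.
Qed.

Lemma intg_shift k (f : Omega -> R) : intg f -> intg (fun w => f (iter k T w)).
Proof. exact: integrable_comp (measurable_iterT k) (@iterT_preserving k) _. Qed.

Lemma Rintegral_shift k (f : Omega -> R) : intg f ->
  \int[P]_w f (iter k T w) = \int[P]_w f w.
Proof. exact: Rintegral_comp (measurable_iterT k) (@iterT_preserving k) _. Qed.

Lemma measurable_shift k (f : Omega -> R) : mfun f -> mfun (fun w => f (iter k T w)).
Proof. by move=> mf; apply: measurableT_comp => //; exact: measurable_iterT. Qed.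

(** Monotonicity of the filtration, read on the inverse map: a set of [F0] is [T^-1 B] with [B] in
    [F0], and its preimage under [Ti] is [B]. *)
Lemma mfun0_Ti : @measurable_fun _ _ TG TG setT Ti.
Proof.
move=> _ A; rewrite setTI !(g_measurableE sF) => /(sa_nondecreasing H)[B FB <-].
by rewrite -comp_preimage (_ : _ \o _ = id) //; apply/funext => w /=; rewrite TiK.
Qed.

Lemma mfun0_iterTi k (f : Omega -> R) : mfun0 f -> mfun0 (fun w => f (iter k Ti w)).
Proof.
move=> mf; elim: k => // k IH.
have -> : (fun w => f (iter k.+1 Ti w)) = (fun w => f (iter k Ti w)) \o Ti.
  by apply/funext => w; rewrite iterSr.
exact: (@measurableT_comp _ _ _ TG TG _ _ _ _ IH mfun0_Ti).
Qed.

Lemma partial_sumE n w : S n w = \sum_(1 <= j < n.+1) X0 (iter j T w).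
Proof. by []. Qed.

Lemma partial_sum0 w : S 0 w = 0.
Proof. by rewrite partial_sumE big_geq. Qed.

Lemma partial_sumD i j w : S (i + j)%N w = S i w + S j (iter i T w).
Proof.
rewrite !partial_sumE (@big_cat_nat _ _ _ i.+1 1 (i + j).+1)//=; last first.
  by rewrite ltnS leq_addr.
congr (_ + _).
rewrite -{1}(add1n i) big_addn subSn ?leq_addr// addKn.
by apply: eq_bigr => k _; rewrite iterD.
Qed.

Lemma mfun0_X0 : mfun0 X0.
Proof. exact/(measurable_wrtP sF)/(sa_adapted H). Qed.

(** Encodes that [S_i] is [F_k]-measurable: after composition with [T^-k], only nonnegative powers
    of [Ti] act on [X0]. *)
Lemma mfun0_partial_sum i k : (i <= k)%N -> mfun0 (fun w => S i (iter k Ti w)).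
Proof.
move=> ik; have -> : (fun w => S i (iter k Ti w)) =
    (fun w => \sum_(1 <= j < i.+1) X0 (iter (k - j) Ti w)).
  apply/funext => w; rewrite partial_sumE; apply: eq_big_nat => j /andP[_ ji].
  by congr X0; rewrite -{1}(subnKC (leq_trans (ji : (j <= i)%N) ik)) iterD iterTiK.
by apply: measurable_sum => j; apply: mfun0_iterTi; exact: mfun0_X0.
Qed.

Lemma measurable_partial_sum i : mfun (S i).
Proof.
apply: measurable_sum => j; apply: (@measurable_shift j X0).
exact: (g_measurable_fun sF mfun0_X0).
Qed.

Lemma intg_powRD (f g : Omega -> R) r : 0 <= r -> mfun f -> mfun g ->
  intg (fun w => `|f w| `^ r) -> intg (fun w => `|g w| `^ r) ->
  intg (fun w => `|f w + g w| `^ r).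
Proof.
move=> r0 mf mg iF iG.
apply: (@integrable_dominated _ _ _ _ _ (fun w => 2 `^ r * (`|f w| `^ r + `|g w| `^ r))).
- by apply: measurable_norm_powR; exact: measurable_funD.
- move=> w; rewrite ger0_norm ?powR_ge0//.
  apply: le_trans (powRD_le r0 (normr_ge0 _) (normr_ge0 _)).
  by apply: le_powR => //; exact: ler_normD.
- by apply: intgZ; exact: intgD.
Qed.

Lemma intg_partial_sum n : intg (fun w => `|S n w| `^ p).
Proof.
have iX0 : intg (fun w => `|X0 w| `^ p).
  have p1 : 1 <= p by rewrite ltW// (lt_trans _ p2)// ltr1n.
  exact: (Lfun_integrable p1 (sa_Lp H)).
elim: n => [|n IH].
  under eq_fun do rewrite partial_sum0 normr0 powR0 ?(gt_eqF (lt_trans _ p2))//.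
  exact: finite_measure_integrable_cst.
under eq_fun do rewrite -addn1 partial_sumD.
apply: intg_powRD => //; first by move: p2; lra.
- exact: measurable_partial_sum.
- exact/measurable_shift/measurable_partial_sum.
- apply: (@intg_shift n (fun w => `|S 1 w| `^ p)).
  under eq_fun do rewrite partial_sumE big_nat1.
  exact: (@intg_shift 1 (fun w => `|X0 w| `^ p)).
Qed.

(* With [F_k = T^-k F_0], a function [h] is [F_k]-measurable when
   [h \o T^-k] is [F_0]-measurable. *)
Lemma pull_out_shift k (Z Y h : Omega -> R) : intg Z -> is_condexp P F0 Z Y ->
  mfun0 (fun w => h (iter k Ti w)) ->
  intg (fun w => h w * Z (iter k T w)) -> intg (fun w => h w * Y (iter k T w)) ->
  \int[P]_w (h w * Z (iter k T w)) = \int[P]_w (h w * Y (iter k T w)).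
Proof.
move=> iZ ZY mh ihZ ihY.
have back X : intg (fun w => h w * X (iter k T w)) ->
    intg (fun w => h (iter k Ti w) * X w).
  move=> /(integrable_comp (measurable_iterTi k) (@iterTi_preserving k)).
  by under eq_fun do rewrite iterTiK.
have E X : intg (fun w => h w * X (iter k T w)) ->
    \int[P]_w (h w * X (iter k T w)) = \int[P]_w (h (iter k Ti w) * X w).
  move=> ihX; rewrite -(Rintegral_shift k (back _ ihX)).
  by under [RHS]eq_Rintegral do rewrite iterTK.
rewrite !E//; apply: (pull_out sF iZ ZY mh); exact: back.
Qed.

(** The last hypothesis is the weak form of [|E_0 Z| <= E_0 W]. The majorant [W] may be measurable
    for the large sigma-algebra only, so it can contain shifted variables; this single statement
    covers both the contraction property and the subadditivity estimates. *)
Lemma condexp_moment (Z W : Omega -> R) r : 1 <= r -> intg Z -> mfun W ->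
  (forall w, 0 <= W w) -> intg (fun w => W w `^ r) ->
  (forall (k : Omega -> R) (B : R), mfun0 k -> (forall w, `|k w| <= B) ->
     \int[P]_w (k w * Z w) <= \int[P]_w (`|k w| * W w)) ->
  intg (fun w => `|condexp P F0 Z w| `^ r) /\
  \int[P]_w (`|condexp P F0 Z w| `^ r) <= \int[P]_w (W w `^ r).
Proof.
move=> r1 iZ mW W0 iW K.
have [/(measurable_wrtP sF) mY iY cY] := condexpP sF iZ; set Y := condexp P F0 Z in mY iY cY *.
have mY' : mfun Y by exact: (g_measurable_fun sF).
have maY : mfun0 (fun w => `|Y w|) by exact: measurableT_comp.
have iW1 : intg W.
  by apply: (intg_of_powR r1) => //; under eq_fun do rewrite ger0_norm//.
apply: moment_domination => //.
  exact: (g_measurable_fun sF).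
move=> phi B mphi phiB _.
have phi0 x : 0 <= phi x by case/andP: (phiB x).
have mphiY : mfun0 (fun w => phi `|Y w|) by exact: (measurableT_comp (f := phi)).
(* The sign is included so that [k Y = phi(|Y|) |Y|], while [k] stays bounded and
   [F0]-measurable. *)
pose k w := phi `|Y w| * Num.sg (Y w).
have mk : mfun0 k by apply: measurable_funM => //; exact: measurable_sg.
have kB w : `|k w| <= B.
  rewrite /k normrM normr_sg (ger0_norm (phi0 _)).
  apply: le_trans (_ : phi `|Y w| <= _); last by case/andP: (phiB `|Y w|).
  by rewrite -[leRHS]mulr1 ler_wpM2l// lern1 leq_b1.
have ik X : intg X -> intg (fun w => k w * X w).
  move=> iX; apply: (integrable_dominated _ _ (intgZ B (integrable_norm iX))).
    apply: measurable_funM; last exact: measurable_intg iX.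
    exact: (g_measurable_fun sF).
  by move=> w; rewrite /= normrM ler_wpM2r.
have -> : \int[P]_w (phi `|Y w| * `|Y w|) = \int[P]_w (k w * Y w).
  by apply: eq_Rintegral => w _; rewrite /k -mulrA -normrEsg.
rewrite -(pull_out sF iZ (condexpP sF iZ) mk (ik _ iZ) (ik _ iY)).
apply: le_trans (K k B mk kB) _; apply: le_Rintegral => //.
- apply: (integrable_dominated _ _ (integrable_norm (ik W iW1))).
    apply: measurable_funM => //; apply: measurableT_comp => //.
    exact: (g_measurable_fun sF).
  by move=> w; rewrite /= (normrM (k w)) (normrM `|k w|) normr_id.
- apply: (integrable_dominated _ _ (intgZ B iW1)).
    apply: measurable_funM => //; exact: (g_measurable_fun sF).
  move=> w; rewrite ger0_norm ?mulr_ge0// ler_wpM2r//.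
  by case/andP: (phiB `|Y w|).
- move=> w _; rewrite ler_wpM2r// /k normrM normr_sg (ger0_norm (phi0 _)).
  by rewrite -[leRHS]mulr1 ler_wpM2l// lern1 leq_b1.
Qed.
End stationary.

Section moments.
Context d (Omega : measurableType d) (R : realType) (P : probability Omega R).
Local Notation intg f := (P.-integrable setT (EFin \o f)).
Local Notation mfun f := (measurable_fun setT f).

Lemma intg_mul_interp (f g F G : Omega -> R) t : 0 <= t <= 1 -> mfun f -> mfun g ->
  (forall w, 0 <= F w) -> (forall w, 0 <= G w) -> intg F -> intg G ->
  (forall w, `|f w| <= F w `^ (1 - t)) -> (forall w, `|g w| <= G w `^ t) ->
  intg (fun w => f w * g w).
Proof.
move=> t01 mf mg F0 G0 iF iG fF gG.
apply: (integrable_dominated _ _ (intg_interp F0 G0 t01 iF iG)).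
  exact: measurable_funM.
by move=> w; rewrite normrM ler_pM.
Qed.

Lemma Rintegral_mul_interp (f g F G : Omega -> R) t : 0 <= t <= 1 ->
  mfun f -> mfun g ->
  (forall w, 0 <= F w) -> (forall w, 0 <= G w) -> intg F -> intg G ->
  (forall w, `|f w| <= F w `^ (1 - t)) -> (forall w, `|g w| <= G w `^ t) ->
  \int[P]_w (f w * g w) <= (\int[P]_w F w) `^ (1 - t) * (\int[P]_w G w) `^ t.
Proof.
move=> t01 mf mg F0 G0 iF iG fF gG.
apply: le_trans (Rintegral_interp F0 G0 t01 iF iG).
apply: le_Rintegral => //; [exact: (intg_mul_interp t01 mf mg F0 G0 iF iG fF gG)|exact: intg_interp|].
by move=> w _; rewrite (le_trans (ler_norm _))// normrM ler_pM.
Qed.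

Lemma powR_sqr_half (x p : R) : (`|x ^+ 2|) `^ (p / 2) = `|x| `^ p.
Proof.
rewrite normrX -powR_mulrn// -powRrM; congr (_ `^ _).
by rewrite mulrCA mulfV ?mulr1// pnatr_eq0.
Qed.
End moments.

(** * Moments of conditional expectations of partial sums and their squares *)

Section stationary_moments.
Context d (Omega : measurableType d) (R : realType) (P : probability Omega R).
Variables (p : R) (T Ti : Omega -> Omega) (F0 : set (set Omega)) (X0 : Omega -> R).
Hypotheses (H : stationary_adapted_Lp P p T Ti F0 X0) (p2 : 2 < p).
Local Notation intg f := (P.-integrable setT (EFin \o f)).
Local Notation mfun f := (measurable_fun setT f).
Let TG := g_sigma_algebraType F0.
Local Notation mfun0 f := (measurable_fun [set: TG] f).
Local Notation S := (partial_sum (shift_process T Ti X0)).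
Local Notation Y n := (condexp P F0 (S n)).
Local Notation V n := (condexp P F0 (fun w => S n w ^+ 2)).

Let sF : Defs.sub_sigma_algebra F0. Proof. exact: sa_sub H. Qed.
Let p1 : 1 <= p. Proof. by move: p2; lra. Qed.
Let r1 : 1 <= p / 2. Proof. by move: p2; lra. Qed.
Let mS n : mfun (S n). Proof. exact: (measurable_partial_sum H). Qed.
Let mS2 n : mfun (fun w => S n w ^+ 2). Proof. exact: measurable_funX. Qed.
Let iSp n : intg (fun w => `|S n w| `^ p). Proof. exact: (intg_partial_sum H p2). Qed.

Lemma intg_partial_sum1 n : intg (S n).
Proof. exact: intg_of_powR (iSp n). Qed.

Lemma intg_partial_sum_sqr n : intg (fun w => S n w ^+ 2).
Proof.
apply: (intg_of_powR r1) => //; under eq_fun do rewrite powR_sqr_half.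
exact: iSp.
Qed.

Let iS := intg_partial_sum1.
Let iS2 := intg_partial_sum_sqr.
Let cY n := condexpP sF (iS n).
Let cV n := condexpP sF (iS2 n).

Lemma mfun0_condexp_sum n : mfun0 (Y n).
Proof. by case: (cY n) => /(measurable_wrtP sF). Qed.

Lemma mfun0_condexp_sqr n : mfun0 (V n).
Proof. by case: (cV n) => /(measurable_wrtP sF). Qed.

Lemma measurable_condexp_sum n : mfun (Y n).
Proof. exact: (g_measurable_fun sF (mfun0_condexp_sum n)). Qed.

Lemma measurable_condexp_sqr n : mfun (V n).
Proof. exact: (g_measurable_fun sF (mfun0_condexp_sqr n)). Qed.

Let iY n : intg (Y n). Proof. by case: (cY n). Qed.
Let iV n : intg (V n). Proof. by case: (cV n). Qed.

Lemma intg_bounded_mul (k X : Omega -> R) B : mfun k -> (forall w, `|k w| <= B) ->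
  intg X -> intg (fun w => k w * X w).
Proof.
move=> mk kB iX; apply: (integrable_dominated _ _ (intgZ B (integrable_norm iX))).
  by apply: measurable_funM => //; exact: measurable_intg iX.
by move=> w; rewrite /= normrM ler_wpM2r.
Qed.

(** Since [F_0] is contained in [F_i], [k] is also [F_i]-measurable, and [Z o T^i] is a version of
    the conditional expectation of [X o T^i] given [F_i]. *)
Let kpull (k : Omega -> R) B i (X Z : Omega -> R) : mfun0 k -> (forall w, `|k w| <= B) ->
  intg X -> is_condexp P F0 X Z ->
  \int[P]_w (k w * X (iter i T w)) = \int[P]_w (k w * Z (iter i T w)).
Proof.
move=> mk kB iX XZ; have mk' : mfun k by exact: (g_measurable_fun sF).
have iZ : intg Z by case: XZ.
apply: (pull_out_shift H iX XZ).
- exact: (mfun0_iterTi H).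
- exact: (intg_bounded_mul mk' kB (intg_shift H i iX)).
- exact: (intg_bounded_mul mk' kB (intg_shift H i iZ)).
Qed.

Lemma condexp_sum_moment n : intg (fun w => `|Y n w| `^ p) /\
  \int[P]_w (`|Y n w| `^ p) <= \int[P]_w (`|S n w| `^ p).
Proof.
apply: (@condexp_moment _ _ _ _ _ _ _ _ _ H _ (fun w => `|S n w|)) => //.
  exact: measurableT_comp.
move=> k B mk kB; have mk' : mfun k by exact: (g_measurable_fun sF).
have ikS := intg_bounded_mul mk' kB (iS n).
apply: le_Rintegral => //.
  have := integrable_norm ikS.
  by apply: eq_integrable => // w _ /=; rewrite normrM.
by move=> w _; rewrite -normrM ler_norm.
Qed.

Lemma condexp_sqr_moment n : intg (fun w => `|V n w| `^ (p / 2)) /\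
  \int[P]_w (`|V n w| `^ (p / 2)) <= \int[P]_w (`|S n w| `^ p).
Proof.
have E : (fun w => `|S n w| `^ p) = (fun w => (S n w ^+ 2) `^ (p / 2)).
  by apply/funext => w; rewrite -powR_sqr_half ger0_norm ?sqr_ge0.
rewrite [X in _ /\ _ <= Rintegral _ _ X]E.
apply: (@condexp_moment _ _ _ _ _ _ _ _ _ H _ (fun w => S n w ^+ 2)) => //.
- by move=> w; exact: sqr_ge0.
- by rewrite -E.
move=> k B mk kB; have mk' : mfun k by exact: (g_measurable_fun sF).
have ikS := intg_bounded_mul mk' kB (iS2 n).
apply: le_Rintegral => //.
  by apply: (intg_bounded_mul (B := B)) => //; [exact: measurableT_comp|move=> w; rewrite normr_id].
by move=> w _; rewrite ler_wpM2r ?sqr_ge0// ler_norm.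
Qed.

Let iYp n : intg (fun w => `|Y n w| `^ p). Proof. by case: (condexp_sum_moment n). Qed.
Let iVp n : intg (fun w => `|V n w| `^ (p / 2)). Proof. by case: (condexp_sqr_moment n). Qed.
Let mY := measurable_condexp_sum.
Let mV := measurable_condexp_sqr.

(** Tower property: under [E_0] the increment [S_j o T^i] may be replaced by its conditional
    expectation given [F_i], namely [Y_j o T^i], whose moments are those of [Y_j] by
    stationarity. *)
Lemma condexp_sum_subadditive i j :
  \int[P]_w (`|Y (i + j)%N w| `^ p) <=
  2 `^ p * (\int[P]_w (`|Y i w| `^ p) + \int[P]_w (`|Y j w| `^ p)).
Proof.
pose W w := `|Y i w| + `|Y j (iter i T w)|.
have W0 w : 0 <= W w by rewrite addr_ge0.
have mYj : mfun (fun w => Y j (iter i T w)) by exact: (measurable_shift H).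
have mW : mfun W by apply: measurable_funD; exact: measurableT_comp.
have iYj : intg (fun w => `|Y j (iter i T w)| `^ p).
  exact: (intg_shift H i (iYp j)).
have WB w : W w `^ p <= 2 `^ p * (`|Y i w| `^ p + `|Y j (iter i T w)| `^ p).
  by apply: powRD_le => //; exact: le_trans p1.
have iB : intg (fun w => 2 `^ p * (`|Y i w| `^ p + `|Y j (iter i T w)| `^ p)).
  exact/intgZ/intgD.
have iW : intg (fun w => W w `^ p).
  apply: (integrable_dominated _ _ iB).
    exact: (measurableT_comp (measurable_powR p)).
  by move=> w; rewrite ger0_norm ?powR_ge0.
have [] := @condexp_moment _ _ _ _ _ _ _ _ _ H _ W _ p1 (iS (i + j)) mW W0 iW.
  move=> k B mk kB; have mk' : mfun k by exact: (g_measurable_fun sF).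
  have b X : intg X -> intg (fun w => k w * X w) by exact: intg_bounded_mul.
  have iSj := intg_shift H i (iS j).
  have iYj1 := intg_shift H i (iY j).
  have -> : \int[P]_w (k w * S (i + j)%N w) =
      \int[P]_w (k w * Y i w + k w * Y j (iter i T w)).
    rewrite RintegralD//; [|exact: b|exact: b].
    rewrite -(kpull i mk kB (iS j) (cY j)).
    rewrite -(kpull 0 mk kB (iS i) (cY i)) -RintegralD//; [|exact: b|exact: b].
    by apply: eq_Rintegral => w _; rewrite partial_sumD mulrDr.
  apply: le_Rintegral => //.
  - by apply: intgD; exact: b.
  - apply: (intg_bounded_mul (B := B)) => //.
    + exact: measurableT_comp.
    + by move=> w; rewrite normr_id.
    + by apply: intgD; exact: integrable_norm.
  move=> w _; rewrite -mulrDr (le_trans (ler_norm _))// normrM ler_wpM2l//.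
  exact: ler_normD.
move=> _ /le_trans; apply.
apply: (le_trans (le_Rintegral measurableT iW iB (fun w _ => WB w))).
rewrite RintegralZl//; last exact: intgD.
by rewrite RintegralD// (Rintegral_shift H i (iYp j)).
Qed.

(** Of the factor [2^p], one half of the exponent comes from [(x + y)^2 <= 2 x^2 + 2 y^2], the other
    from the power [p / 2] of a sum. *)
Lemma condexp_sqr_subadditive i j :
  \int[P]_w (`|V (i + j)%N w| `^ (p / 2)) <=
  2 `^ p * (\int[P]_w (`|V i w| `^ (p / 2)) + \int[P]_w (`|V j w| `^ (p / 2))).
Proof.
pose W w := 2 * `|V i w| + 2 * `|V j (iter i T w)|.
have W0 w : 0 <= W w by rewrite addr_ge0// mulr_ge0.
have mVj : mfun (fun w => V j (iter i T w)) by exact: (measurable_shift H).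
have mW : mfun W.
  by apply: measurable_funD; apply: measurable_funM => //; exact: measurableT_comp.
have iVj : intg (fun w => `|V j (iter i T w)| `^ (p / 2)).
  exact: (intg_shift H i (iVp j)).
have WB w : W w `^ (p / 2) <=
    2 `^ p * (`|V i w| `^ (p / 2) + `|V j (iter i T w)| `^ (p / 2)).
  rewrite /W -mulrDr powRM ?addr_ge0//.
  have -> : 2 `^ p = 2 `^ (p / 2) * 2 `^ (p / 2) :> R by rewrite -powRD_gt0// -splitr.
  rewrite -mulrA ler_wpM2l ?powR_ge0//.
  by apply: powRD_le => //; exact: le_trans r1.
have iB : intg (fun w => 2 `^ p * (`|V i w| `^ (p / 2) + `|V j (iter i T w)| `^ (p / 2))).
  exact/intgZ/intgD.
have iW : intg (fun w => W w `^ (p / 2)).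
  apply: (integrable_dominated _ _ iB).
    exact: (measurableT_comp (measurable_powR _)).
  by move=> w; rewrite ger0_norm ?powR_ge0.
have [] := @condexp_moment _ _ _ _ _ _ _ _ _ H _ W _ r1 (iS2 (i + j)) mW W0 iW.
  move=> k B mk kB; have mk' : mfun k by exact: (g_measurable_fun sF).
  (* The sign of [k] is given up because the bound on the square of a sum needs a nonnegative
     weight. *)
  pose k' w := 2 * `|k w|.
  have mk0 : mfun0 k' by apply: measurable_funM => //; exact: measurableT_comp.
  have mk0' : mfun k' by exact: (g_measurable_fun sF).
  have kB' w : `|k' w| <= 2 * B by rewrite normrM normr_id ger0_norm// ler_wpM2l.
  have b X : intg X -> intg (fun w => k w * X w) by exact: intg_bounded_mul.
  have b' X : intg X -> intg (fun w => k' w * X w) by exact: intg_bounded_mul.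
  have iSj := intg_shift H i (iS2 j).
  have iVj1 := intg_shift H i (iV j).
  apply: (@le_trans _ _ (\int[P]_w (k' w * S i w ^+ 2 + k' w * S j (iter i T w) ^+ 2))).
    apply: le_Rintegral => //; [exact: b|by apply: intgD; exact: b'|].
    move=> w _; rewrite partial_sumD -mulrDr /k'.
    set x := S i w; set y := S j _.
    apply: (@le_trans _ _ (`|k w| * (x + y) ^+ 2)).
      by rewrite ler_wpM2r ?sqr_ge0// ler_norm.
    rewrite (mulrC 2) -mulrA ler_wpM2l//.
    have := sqr_ge0 (x - y); rewrite sqrrB sqrrD !mulr2n; lra.
  rewrite RintegralD//; [|exact: b'|exact: b'].
  rewrite (kpull i mk0 kB' (iS2 j) (cV j)) (kpull 0 mk0 kB' (iS2 i) (cV i)).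
  rewrite -RintegralD//; [|exact: b'|exact: b'].
  apply: le_Rintegral => //; first by apply: intgD; exact: b'.
    apply: (intg_bounded_mul (B := B)) => //.
    + exact: measurableT_comp.
    + by move=> w; rewrite normr_id.
    + by apply: intgD; apply: intgZ; exact: integrable_norm.
  move=> w _; rewrite /k' /W /=.
  have k0 : 0 <= `|k w| by [].
  have := ler_wpM2l k0 (ler_norm (V i w)); have := ler_wpM2l k0 (ler_norm (V j (iter i T w))).
  lra.
move=> _ /le_trans; apply.
apply: (le_trans (le_Rintegral measurableT iW iB (fun w _ => WB w))).
rewrite RintegralZl//; last exact: intgD.
by rewrite RintegralD// (Rintegral_shift H i (iVp j)).
Qed.

(** Conditional Jensen, [(E_0 S_n)^2 <= E_0 (S_n^2)], in weak form: integrate [k (Y - S)^2 >= 0]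
    with [k >= 0] measurable for [F0], where [k Y S] has the same integral as [k Y^2]. *)
Lemma condexp_sum_le_sqr n :
  \int[P]_w (`|Y n w| `^ p) <= \int[P]_w (`|V n w| `^ (p / 2)).
Proof.
have E : (fun w => `|Y n w| `^ p) = (fun w => (Y n w ^+ 2) `^ (p / 2)).
  by apply/funext => w; rewrite -powR_sqr_half ger0_norm ?sqr_ge0.
have iY2 : intg (fun w => Y n w ^+ 2).
  apply: (intg_of_powR r1) => //; first exact: measurable_funX.
  by under eq_fun do rewrite powR_sqr_half; exact: iYp.
rewrite [X in Rintegral _ _ X <= _]E.
apply: (proj2 (@moment_domination _ _ _ P (p / 2) (fun w => Y n w ^+ 2)
  (fun w => `|V n w|) r1 _ _ _ _ (iVp n) _)).
- exact: measurable_funX.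
- exact: measurableT_comp.
- by move=> w; exact: sqr_ge0.
- by [].
move=> phi B mphi phiB _.
pose k w := phi (Y n w ^+ 2); have k0 w : 0 <= k w by case/andP: (phiB (Y n w ^+ 2)).
have mk : mfun0 k.
  apply: (measurableT_comp (f := phi)) => //; apply: measurable_funX.
  exact: mfun0_condexp_sum.
have mk' : mfun k by exact: (g_measurable_fun sF).
have kB w : `|k w| <= B by rewrite ger0_norm//; case/andP: (phiB (Y n w ^+ 2)).
have b X : intg X -> intg (fun w => k w * X w) by exact: intg_bounded_mul.
have iYS : intg (fun w => Y n w * S n w).
  apply: (integrable_dominated _ _ (intgD iY2 (iS2 n))); first exact: measurable_funM.
  move=> w; rewrite normrM.
  have := sqr_ge0 (`|Y n w| - `|S n w|).
  rewrite sqrrB !real_normK ?num_real// mulr2n.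
  have := mulr_ge0 (normr_ge0 (Y n w)) (normr_ge0 (S n w)); lra.
have mkY : mfun0 (fun w => k w * Y n w).
  by apply: measurable_funM => //; exact: mfun0_condexp_sum.
have e1 : \int[P]_w (k w * (Y n w * S n w)) = \int[P]_w (k w * Y n w ^+ 2).
  transitivity (\int[P]_w ((k w * Y n w) * S n w)).
    by apply: eq_Rintegral => w _; rewrite mulrA.
  rewrite (pull_out sF (iS n) (cY n) mkY).
  - by apply: eq_Rintegral => w _; rewrite -mulrA -expr2.
  - by under eq_fun do rewrite -mulrA; exact: b.
  - by under eq_fun do rewrite -mulrA -expr2; exact: b.
have e2 : \int[P]_w (k w * S n w ^+ 2) <= \int[P]_w (k w * `|V n w|).
  rewrite (kpull 0 mk kB (iS2 n) (cV n)); apply: le_Rintegral => //.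
  - exact: b.
  - by apply: b; exact: integrable_norm.
  - by move=> w _; rewrite ler_wpM2l// ler_norm.
apply: le_trans e2.
have : \int[P]_w (2 * (k w * (Y n w * S n w)) - k w * Y n w ^+ 2) <=
       \int[P]_w (k w * S n w ^+ 2).
  apply: le_Rintegral => //.
  - by apply: intgB; [apply: intgZ; exact: b|exact: b].
  - exact: b.
  move=> w _; have := mulr_ge0 (k0 w) (sqr_ge0 (Y n w - S n w)).
  by rewrite sqrrB mulr2n; lra.
rewrite RintegralB//; [|by apply: intgZ; exact: b|exact: b].
rewrite RintegralZl//; last exact: b.
by rewrite e1 /k; lra.
Qed.
End stationary_moments.

(** * The doubling inequality and the maximal inequality *)

Section stationary_inequalities.
Context d (Omega : measurableType d) (R : realType) (P : probability Omega R).
Variables (p : R) (T Ti : Omega -> Omega) (F0 : set (set Omega)) (X0 : Omega -> R).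
Hypotheses (H : stationary_adapted_Lp P p T Ti F0 X0) (p2 : 2 < p).
Local Notation intg f := (P.-integrable setT (EFin \o f)).
Local Notation mfun f := (measurable_fun setT f).
Let TG := g_sigma_algebraType F0.
Local Notation mfun0 f := (measurable_fun [set: TG] f).
Local Notation S := (partial_sum (shift_process T Ti X0)).
Local Notation Y n := (condexp P F0 (S n)).
Local Notation V n := (condexp P F0 (fun w => S n w ^+ 2)).
Local Notation mS n := (\int[P]_w (`|S n w| `^ p)).
Local Notation mY n := (\int[P]_w (`|Y n w| `^ p)).
Local Notation mV n := (\int[P]_w (`|V n w| `^ (p / 2))).

Let sF : Defs.sub_sigma_algebra F0. Proof. exact: sa_sub H. Qed.
Let p_gt0 : 0 < p. Proof. by move: p2; lra. Qed.
Let pinv01 : 0 <= p^-1 <= 1.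
Proof. by apply/andP; split; [rewrite invr_ge0 ltW|rewrite invf_le1//; move: p2; lra]. Qed.
Let pinv2 : 0 <= 2 / p <= 1.
Proof.
by apply/andP; split; [rewrite divr_ge0// ltW|rewrite ler_pdivrMr//; move: p2; lra].
Qed.
Let meS n : mfun (S n). Proof. exact: (measurable_partial_sum H). Qed.
Let iSp n : intg (fun w => `|S n w| `^ p). Proof. exact: (intg_partial_sum H p2). Qed.
Let iYp n : intg (fun w => `|Y n w| `^ p).
Proof. by case: (condexp_sum_moment H p2 n). Qed.
Let iVp n : intg (fun w => `|V n w| `^ (p / 2)).
Proof. by case: (condexp_sqr_moment H p2 n). Qed.
Let iS n : intg (S n). Proof. exact: (intg_partial_sum1 H p2). Qed.
Let iS2 n : intg (fun w => S n w ^+ 2). Proof. exact: (intg_partial_sum_sqr H p2). Qed.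
Let meY n : mfun (Y n). Proof. exact: (measurable_condexp_sum H p2). Qed.
Let meV n : mfun (V n). Proof. exact: (measurable_condexp_sqr H p2). Qed.

Let powRpV x : 0 <= x -> (x `^ p) `^ p^-1 = x.
Proof. by move=> x0; rewrite -powRrM mulfV ?powRr1// gt_eqF. Qed.

Let powRp1 x : (x `^ p) `^ (1 - p^-1) = x `^ (p - 1).
Proof. by rewrite -powRrM mulrBr mulr1 mulfV// gt_eqF. Qed.

Let powRp2 x : (x `^ p) `^ (1 - 2 / p) = x `^ (p - 2).
Proof. by rewrite -powRrM mulrBr mulr1 mulrCA mulfV ?mulr1// gt_eqF. Qed.

Let powR2p x : 0 <= x -> (x `^ p) `^ (2 / p) = x ^+ 2.
Proof.
by move=> x0; rewrite -powRrM mulrCA mulfV ?mulr1 ?powR_mulrn// gt_eqF.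
Qed.

Let powRh x : 0 <= x -> (x `^ (p / 2)) `^ (2 / p) = x.
Proof.
move=> x0; rewrite -powRrM (_ : p / 2 * (2 / p) = 1) ?powRr1//.
by field; rewrite gt_eqF.
Qed.

(** [K = a^(1-2/p) v^(2/p)] is the Hölder bound for the integral of [G]. As [v <= a] implies
    [K <= a], the term [K] is at most the mixed term [a^(1-e) K^e], and a single power of [v] is
    left. *)
Lemma powR_mix (a v e : R) : 0 <= v -> v <= a -> 0 < e <= 1 ->
  a `^ (1 - 2 / p) * v `^ (2 / p) <= a `^ (1 - e) * (a `^ (1 - 2 / p) * v `^ (2 / p)) `^ e /\
  a `^ (1 - e) * (a `^ (1 - 2 / p) * v `^ (2 / p)) `^ e =
    a `^ (1 - 2 * e / p) * v `^ (2 * e / p).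
Proof.
move=> v0 va /andP[e0 e1]; have a0 : 0 <= a by exact: le_trans va.
have /andP[t0 t1] := pinv2.
have [a00|an0] := eqVneq a 0.
  have -> : v = 0 by move: v0 va; rewrite a00; lra.
  have t00 : 0 < 2 / p by rewrite divr_gt0.
  have t0e : 0 < 2 * e / p by rewrite divr_gt0// mulr_gt0.
  have z1 : 0 `^ (2 / p) = 0 :> R by rewrite powR0// gt_eqF.
  have z2 : 0 `^ (2 * e / p) = 0 :> R by rewrite powR0// gt_eqF.
  have z3 : 0 `^ e = 0 :> R by rewrite powR0// gt_eqF.
  by rewrite z1 z2 mulr0 z3 !mulr0.
have ap : 0 < a by rewrite lt0r an0.
set K := _ * v `^ (2 / p).
have K0 : 0 <= K by rewrite mulr_ge0 ?powR_ge0.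
have Ka : K <= a.
  rewrite -[leRHS](powRr1 a0) -[X in a `^ X](subrK (2 / p)) powRD_gt0//.
  by rewrite ler_wpM2l ?powR_ge0// le_powR.
split.
  have [K00|Kn0] := eqVneq K 0; first by rewrite K00 mulr_ge0 ?powR_ge0.
  have Kp : 0 < K by rewrite lt0r Kn0.
  rewrite -[leLHS](powRr1 K0) -[X in K `^ X](subrK e) powRD_gt0//.
  by rewrite ler_wpM2r ?powR_ge0// le_powR//; lra.
rewrite powRM ?powR_ge0// -!powRrM mulrA -powRD_gt0//.
by congr (_ `^ _ * _ `^ _); field; rewrite gt_eqF.
Qed.

Let doubling_arith (c x y z a b q C : R) : q * x <= q * a -> C * y <= C * b ->
  C * z <= C * b -> c + c + q * x + C * (y + z) <= 2 * c + (q * a + 2 * C * b).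
Proof. lra. Qed.

(** The pathwise expansion is taken as a hypothesis so that its constant [C], known only to exist,
    is the same for all [n] and all probability spaces. *)
Lemma moment_doubling (C : R) n (e := rosenthal_delta p) : 0 <= C ->
  (forall x y F G, F = `|y| `^ p -> G = `|x| `^ (p - 2) * y ^+ 2 ->
    `|x + y| `^ p <= `|x| `^ p + F + p * (Num.sg x * `|x| `^ (p - 1)) * y
                     + C * (G + F `^ (1 - e) * G `^ e)) ->
  mS (n + n)%N <= 2 * mS n +
    (p * (mS n `^ (1 - p^-1) * mY n `^ p^-1) +
     2 * C * (mS n `^ (1 - 2 * e / p) * mV n `^ (2 * e / p))).
Proof.
move=> C0 HC; have [e0 e1 _] := rosenthal_deltaP p2; rewrite -/e in e0 e1.
have e01 : 0 <= e <= 1 by rewrite ltW.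
pose tn w := iter n T w.
pose f w := Num.sg (S n w) * `|S n w| `^ (p - 1).
pose F w := `|S n (tn w)| `^ p.
pose G w := `|S n w| `^ (p - 2) * S n (tn w) ^+ 2.
have F0' w : 0 <= F w by exact: powR_ge0.
have G0 w : 0 <= G w by rewrite mulr_ge0 ?powR_ge0 ?sqr_ge0.
have iF : intg F by exact: (intg_shift H n (iSp n)).
have mSt : mfun (fun w => S n (tn w)) by exact: (measurable_shift H).
have mf : mfun f.
  by apply: measurable_funM; [exact: measurable_sg|exact: measurable_norm_powR].
have fB w : `|f w| <= (`|S n w| `^ p) `^ (1 - p^-1).
  rewrite powRp1 normrM normr_sg (ger0_norm (powR_ge0 _ _)) ler_piMl ?powR_ge0//.
  by rewrite lern1 leq_b1.
have mm2 : mfun (fun w => `|S n w| `^ (p - 2)) by exact: measurable_norm_powR.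
have m2B w : `|(`|S n w| `^ (p - 2))| <= (`|S n w| `^ p) `^ (1 - 2 / p).
  by rewrite powRp2 ger0_norm ?powR_ge0.
have yB w : `|S n (tn w)| <= F w `^ p^-1 by rewrite powRpV.
have y2B w : `|S n (tn w) ^+ 2| <= F w `^ (2 / p).
  by rewrite powR2p// normrX.
have iYt : intg (fun w => `|Y n (tn w)| `^ p) by exact: (intg_shift H n (iYp n)).
have iVt : intg (fun w => `|V n (tn w)| `^ (p / 2)) by exact: (intg_shift H n (iVp n)).
have mYt : mfun (fun w => Y n (tn w)) by exact: (measurable_shift H).
have mVt : mfun (fun w => V n (tn w)) by exact: (measurable_shift H).
have mSt2 : mfun (fun w => S n (tn w) ^+ 2) by exact: measurable_funX.
have YB w : `|Y n (tn w)| <= (`|Y n (tn w)| `^ p) `^ p^-1 by rewrite powRpV.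
have VB w : `|V n (tn w)| <= (`|V n (tn w)| `^ (p / 2)) `^ (2 / p) by rewrite powRh.
have np w : 0 <= `|S n w| `^ p by exact: powR_ge0.
have nY w : 0 <= `|Y n (tn w)| `^ p by exact: powR_ge0.
have nV w : 0 <= `|V n (tn w)| `^ (p / 2) by exact: powR_ge0.
have ify : intg (fun w => f w * S n (tn w)).
  exact: (intg_mul_interp pinv01 mf mSt np F0' (iSp n) iF fB yB).
have ifY : intg (fun w => f w * Y n (tn w)).
  exact: (intg_mul_interp pinv01 mf mYt np nY (iSp n) iYt fB YB).
have iG : intg G.
  exact: (intg_mul_interp pinv2 mm2 mSt2 np F0' (iSp n) iF m2B y2B).
have iGV : intg (fun w => `|S n w| `^ (p - 2) * V n (tn w)).
  exact: (intg_mul_interp pinv2 mm2 mVt np nV (iSp n) iVt m2B VB).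
have mSn : mfun0 (fun w => S n (iter n Ti w)) by exact: (mfun0_partial_sum H).
have L1 : \int[P]_w (f w * S n (tn w)) <= mS n `^ (1 - p^-1) * mY n `^ p^-1.
  rewrite (pull_out_shift H (iS n) (condexpP sF (iS n)) _ ify ifY); last first.
    apply: measurable_funM; first exact: measurable_sg.
    by apply: (measurableT_comp (measurable_powR _)); exact: measurableT_comp.
  rewrite -[mY n](Rintegral_shift H n (iYp n)).
  exact: (Rintegral_mul_interp pinv01 mf mYt np nY (iSp n) iYt fB YB).
have L2 : \int[P]_w G w <= mS n `^ (1 - 2 / p) * mV n `^ (2 / p).
  have -> : \int[P]_w G w = \int[P]_w (`|S n w| `^ (p - 2) * V n (tn w)).
    apply: (pull_out_shift H (iS2 n) (condexpP sF (iS2 n)) _ iG iGV).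
    by apply: (measurableT_comp (measurable_powR _)); exact: measurableT_comp.
  rewrite -[mV n](Rintegral_shift H n (iVp n)).
  exact: (Rintegral_mul_interp pinv2 mm2 mVt np nV (iSp n) iVt m2B VB).
have mV0 : 0 <= mV n by apply: Rintegral_ge0 => w _; exact: powR_ge0.
have mS0 : 0 <= mS n by apply: Rintegral_ge0 => w _; exact: powR_ge0.
have mVS : mV n <= mS n by case: (condexp_sqr_moment H p2 n).
have [K1 K2] := powR_mix mV0 mVS (introT andP (conj e0 e1)).
have EF : \int[P]_w F w = mS n by exact: (Rintegral_shift H n (iSp n)).
(* Hölder separates [F], whose integral is [mS n] by stationarity, from [G], the only factor that
   was conditioned. *)
have L3 : \int[P]_w (F w `^ (1 - e) * G w `^ e) <=
    mS n `^ (1 - 2 * e / p) * mV n `^ (2 * e / p).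
  apply: (le_trans (Rintegral_interp F0' G0 e01 iF iG)).
  rewrite EF -K2; apply: ler_wpM2l; first exact: powR_ge0.
  by apply: le_powR L2; [exact: ltW|apply: Rintegral_ge0 => w _; exact: G0].
have iFG := intg_interp F0' G0 e01 iF iG.
have L4 : \int[P]_w G w <= mS n `^ (1 - 2 * e / p) * mV n `^ (2 * e / p).
  by rewrite -K2; exact: le_trans K1.
have i1 : intg (fun w => `|S n w| `^ p + F w) by exact: intgD.
have i2 : intg (fun w => `|S n w| `^ p + F w + p * (f w * S n (tn w))).
  exact/intgD/intgZ.
have i3 : intg (fun w => G w + F w `^ (1 - e) * G w `^ e) by exact: intgD.
have : mS (n + n)%N <= \int[P]_w (`|S n w| `^ p + F w + p * (f w * S n (tn w)) +
    C * (G w + F w `^ (1 - e) * G w `^ e)).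
  apply: (le_Rintegral measurableT (iSp _) (intgD i2 (intgZ C i3))) => w _.
  rewrite partial_sumD mulrA.
  exact: (HC (S n w) (S n (tn w)) (F w) (G w) erefl erefl).
rewrite (RintegralD measurableT i2 (intgZ C i3)).
rewrite (RintegralD measurableT i1 (intgZ p ify)).
rewrite (RintegralD measurableT (iSp n) iF) EF.
rewrite (RintegralZl _ measurableT ify) (RintegralZl _ measurableT i3).
rewrite (RintegralD measurableT iG iFG) => M.
apply: (le_trans M).
exact: doubling_arith (ler_wpM2l (ltW p_gt0) L1) (ler_wpM2l C0 L4) (ler_wpM2l C0 L3).
Qed.

Local Notation M m w := (running_max (fun j => `|S j w|) m).

Let M0 m w : 0 <= M m w. Proof. exact: running_max_ge0. Qed.

Lemma mfun0_running_max m k : (m <= k)%N -> mfun0 (fun w => M m (iter k Ti w)).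
Proof.
elim: m => [_|m IH mk]; first exact: measurable_cst.
apply: measurable_maxr; first by apply: IH; exact: ltnW.
by apply: measurableT_comp => //; exact: (mfun0_partial_sum H).
Qed.

Lemma measurable_running_max m : mfun (fun w => M m w).
Proof.
elim: m => [|m IH]; first exact: measurable_cst.
by apply: measurable_maxr => //; exact: measurableT_comp.
Qed.

Lemma intg_running_max m : intg (fun w => M m w `^ p).
Proof.
elim: m => [|m IH].
  exact: (finite_measure_integrable_cst P (0 `^ p) measurableT).
apply: (integrable_dominated _ _ (intgD IH (iSp m.+1))).
  exact: (measurableT_comp (measurable_powR p) (measurable_running_max m.+1)).
move=> w; rewrite ger0_norm ?powR_ge0//=.
by case: (leP (M m w) `|S m.+1 w|) => _; rewrite ?lerDr ?lerDl powR_ge0.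
Qed.

(** The weights of Doob's pathwise bound. Each depends on the sums up to [m + 1] only, and together
    they telescope to [M_N^(p-1)]. *)
Let g m w := M m.+1 w `^ (p - 1) - M m w `^ (p - 1).

Let g0 m w : 0 <= g m w.
Proof.
by rewrite subr_ge0; apply: le_powR (running_maxS _ _); [move: p2; lra|exact: M0].
Qed.

Let sum_g N w : \sum_(m < N) g m w = M N w `^ (p - 1).
Proof.
rewrite -(big_mkord xpredT (g ^~ w)) telescope_sumr//= powR0 ?subr0//.
by rewrite gt_eqF//; move: p2; lra.
Qed.

Let g_le m N w : (m < N)%N -> `|g m w| <= (M N w `^ p) `^ (1 - p^-1).
Proof.
move=> mN; rewrite powRp1 ger0_norm// -sum_g (bigD1 (Ordinal mN))//= lerDl.
exact: sumr_ge0.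
Qed.

Let mg m : mfun (g m).
Proof.
by apply: measurable_funB; apply: (measurableT_comp (measurable_powR _));
  exact: measurable_running_max.
Qed.

Let nM N w : 0 <= M N w `^ p. Proof. exact: powR_ge0. Qed.

Let intg_M_mul (f X : Omega -> R) N : mfun f ->
  (forall w, `|f w| <= (M N w `^ p) `^ (1 - p^-1)) ->
  mfun X -> intg (fun w => `|X w| `^ p) -> intg (fun w => f w * X w).
Proof.
move=> mf fM mX iX.
have nX w : 0 <= `|X w| `^ p by exact: powR_ge0.
have XB w : `|X w| <= (`|X w| `^ p) `^ p^-1 by rewrite powRpV.
exact: (intg_mul_interp pinv01 mf mX (nM N) nX (intg_running_max N) iX fM XB).
Qed.

(** As [X] does not depend on [m], the weights can be summed to [M_N^(p-1)] before Hölder's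
    inequality is applied once. *)
Let Rintegral_M_mul (X : Omega -> R) N : (forall w, 0 <= X w) ->
  mfun X -> intg (fun w => X w `^ p) ->
  \sum_(m < N) \int[P]_w (g m w * X w) <=
    (\int[P]_w (M N w `^ p)) `^ (1 - p^-1) * (\int[P]_w (X w `^ p)) `^ p^-1.
Proof.
move=> X0' mX iX.
have nX w : 0 <= X w `^ p by exact: powR_ge0.
have XE : (fun w => `|X w| `^ p) = (fun w => X w `^ p).
  by apply/funext => w; rewrite ger0_norm.
have XB w : `|X w| <= (X w `^ p) `^ p^-1 by rewrite powRpV// ger0_norm.
pose f w := M N w `^ (p - 1).
have mf : mfun f.
  exact: (measurableT_comp (measurable_powR _) (measurable_running_max N)).
have fM w : `|f w| <= (M N w `^ p) `^ (1 - p^-1) by rewrite powRp1 ger0_norm// powR_ge0.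
have iX' : intg (fun w => `|X w| `^ p) by rewrite XE.
have igX (m : 'I_N) : intg (fun w => g m w * X w).
  exact: (intg_M_mul (mg m) (fun w => g_le w (ltn_ord m)) mX iX').
have -> : \sum_(m < N) \int[P]_w (g m w * X w) = \int[P]_w (f w * X w).
  rewrite -(Rintegral_sum _ igX); apply: eq_Rintegral => w _.
  by rewrite -mulr_suml sum_g.
exact: (Rintegral_mul_interp pinv01 mf mX (nM N) nX (intg_running_max N) iX fM XB).
Qed.

(** An [ell^p] norm over the positions of the blocks of length [2^l]. It dominates every block,
    hence does not depend on [m], and its p-th moment grows only by the number of blocks. *)
Let Z r l w := (\sum_(j < 2 ^ (r - l)) `|Y (2 ^ l)%N (iter (j * 2 ^ l) T w)| `^ p) `^ p^-1.

Let Zp r l w : Z r l w `^ p =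
  \sum_(j < 2 ^ (r - l)) `|Y (2 ^ l)%N (iter (j * 2 ^ l) T w)| `^ p.
Proof.
rewrite /Z -powRrM mulVf ?gt_eqF// powRr1//.
by apply: sumr_ge0 => j _; exact: powR_ge0.
Qed.

Let Z0 r l w : 0 <= Z r l w. Proof. exact: powR_ge0. Qed.

Let mZ r l : mfun (Z r l).
Proof.
apply: (measurableT_comp (measurable_powR _)); apply: measurable_sum => j.
by apply: measurable_norm_powR; exact: (measurable_shift H).
Qed.

Let iZ r l : intg (fun w => Z r l w `^ p).
Proof.
under eq_fun do rewrite Zp.
by apply: intg_sum => j _; exact: (intg_shift H _ (iYp _)).
Qed.

Let EZ r l : \int[P]_w (Z r l w `^ p) = (2 ^ (r - l))%:R * mY (2 ^ l)%N.
Proof.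
under eq_Rintegral do rewrite Zp.
rewrite (Rintegral_sum _ (f := fun (j : 'I_(2 ^ (r - l))) w => `|Y (2 ^ l)%N (iter (j * 2 ^ l) T w)| `^ p)).
  under eq_bigr do rewrite (Rintegral_shift H _ (iYp _)).
  by rewrite sumr_const card_ord mulr_natl.
by move=> j; exact: (intg_shift H _ (iYp _)).
Qed.

Let Y_le_Z r l j w : (l < r)%N -> (j.+1 * 2 ^ l <= 2 ^ r)%N ->
  `|Y (2 ^ l)%N (iter (j * 2 ^ l) T w)| <= Z r l w.
Proof.
move=> lr jr; rewrite -[leLHS](powRpV (normr_ge0 _)); apply: le_powR.
- by case/andP: pinv01.
- exact: powR_ge0.
have jlt : (j < 2 ^ (r - l))%N.
  by rewrite -(@leq_pmul2r (2 ^ l)) ?expn_gt0// -expnD subnK// ltnW.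
rewrite (bigD1 (Ordinal jlt))//= lerDl.
by apply: sumr_ge0 => i _; exact: powR_ge0.
Qed.

(* [S (2 ^ r) - S m.+1] is a sum of dyadic blocks lying after [m.+1]; the
   conditional expectation of the block of length [2 ^ l] given its past is at
   most [Z r l], wherever the block starts. *)
Let past_increment r m : (m < 2 ^ r)%N ->
  \int[P]_w (g m w * `|S m.+1 w|) <=
  \int[P]_w (g m w * `|S (2 ^ r)%N w|) + \sum_(l < r) \int[P]_w (g m w * Z r l w).
Proof.
(* The sign turns [g |S_(m+1)|] into the linear expression [h S_(m+1)], with [h] still determined by
   the past at time [m + 1]. *)
move=> mr; pose h w := Num.sg (S m.+1 w) * g m w.
have mh : mfun h by apply: measurable_funM => //; exact: measurable_sg.
have hg w : `|h w| <= g m w.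
  rewrite normrM normr_sg (ger0_norm (g0 _ _)) ler_piMl//.
  by rewrite lern1 leq_b1.
have hM w : `|h w| <= (M (2 ^ r)%N w `^ p) `^ (1 - p^-1).
  by apply: (le_trans (hg w)); rewrite -(ger0_norm (g0 m w)); exact: g_le.
have ih (X : Omega -> R) : mfun X -> intg (fun w => `|X w| `^ p) -> intg (fun w => h w * X w).
  by move=> mX; exact: (intg_M_mul mh hM mX).
have ig (X : Omega -> R) : mfun X -> intg (fun w => `|X w| `^ p) -> intg (fun w => g m w * X w).
  move=> mX; exact: (intg_M_mul (mg m) (fun w => g_le w mr) mX).
have iZ' l : intg (fun w => `|Z r l w| `^ p).
  by under eq_fun do rewrite (ger0_norm (Z0 _ _ _)); exact: iZ.
have iaS n : intg (fun w => `| `|S n w| | `^ p).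
  by under eq_fun do rewrite normr_id; exact: iSp.
have maS n : mfun (fun w => `|S n w|) by exact: measurableT_comp.
have hle (X X' : Omega -> R) : mfun X -> intg (fun w => `|X w| `^ p) ->
    mfun X' -> intg (fun w => `|X' w| `^ p) -> (forall w, `|X w| <= X' w) ->
    \int[P]_w (h w * X w) <= \int[P]_w (g m w * X' w).
  move=> mX iX mX' iX' XX; apply: (le_Rintegral measurableT (ih _ mX iX) (ig _ mX' iX')).
  move=> w _; apply: le_trans (ler_norm _) _; rewrite normrM.
  by apply: ler_pM; rewrite ?normr_ge0// (le_trans (hg w)).
(* The minus sign makes [e (2^r) - e (m+1)] the excess of the integral of [h S_(m+1)] over that of
   [h S_(2^r)], the quantity that chaining bounds. *)
pose e n := - \int[P]_w (h w * S n w).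
pose z l := \int[P]_w (g m w * Z r l w).
have z0 l : 0 <= z l by apply: Rintegral_ge0 => w _; exact: mulr_ge0.
have mhTi k : (m < k)%N -> mfun0 (fun w => h (iter k Ti w)).
  move=> mk; apply: measurable_funM.
    by apply: measurable_sg; exact: (mfun0_partial_sum H).
  by apply: measurable_funB; apply: (measurableT_comp (measurable_powR _));
    apply: mfun0_running_max => //; exact: ltnW.
have := @dyadic_chaining R e z r m.+1 z0.
move=> /(_ _ mr)/wrap[].
  move=> l j lr mj jr.
  have SE : \int[P]_w (h w * S (j.+1 * 2 ^ l)%N w) =
      \int[P]_w (h w * S (j * 2 ^ l)%N w) +
      \int[P]_w (h w * S (2 ^ l)%N (iter (j * 2 ^ l) T w)).
    rewrite -(RintegralD measurableT); last 2 first.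
    - exact: ih.
    - by apply: ih; [exact: (measurable_shift H)|exact: (intg_shift H _ (iSp _))].
    by apply: eq_Rintegral => w _; rewrite mulSnr partial_sumD mulrDr.
  rewrite /e SE opprD addrAC subrr add0r.
  have iT (X : Omega -> R) : mfun X -> intg (fun w => `|X w| `^ p) ->
      intg (fun w => h w * X (iter (j * 2 ^ l) T w)).
    move=> mX iX; apply: ih; first exact: (measurable_shift H).
    exact: (intg_shift H _ iX).
  rewrite (pull_out_shift H (iS _) (condexpP sF (iS _)) (mhTi _ mj)
    (iT _ (meS _) (iSp _)) (iT _ (meY _) (iYp _))).
  apply: le_trans (ler_norm _) _; rewrite normrN.
  apply: (le_trans (le_normr_Rintegral measurableT (iT _ (meY _) (iYp _)))).
  apply: (le_Rintegral measurableT (integrable_norm (iT _ (meY _) (iYp _))) (ig _ (mZ r l) (iZ' l))).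
  by move=> w _ /=; rewrite normrM; apply: ler_pM => //; exact: Y_le_Z.
rewrite /e opprK.
have -> : \int[P]_w (h w * S m.+1 w) = \int[P]_w (g m w * `|S m.+1 w|).
  by apply: eq_Rintegral => w _; rewrite /h [in RHS]normrEsg mulrCA mulrA.
have := hle _ _ (meS (2 ^ r)%N) (iSp _) (maS (2 ^ r)%N) (iaS _) (fun=> lexx _).
rewrite /z; lra.
Qed.

(** As in Doob's inequality, [W <= p / (p - 1) W^(1-1/p) X] is obtained first, and the power of [W]
    is divided out; the running maximum is already known to have a finite p-th moment. *)
Lemma stationary_maximal_inequality r :
  \int[P]_w (M (2 ^ r)%N w `^ p) <= (p / (p - 1) * (mS (2 ^ r)%N `^ p^-1 +
    \sum_(l < r) ((2 ^ (r - l))%:R * mY (2 ^ l)%N) `^ p^-1)) `^ p.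
Proof.
set N := (2 ^ r)%N; set W := \int[P]_w _; set X := (X in (_ * X) `^ p).
have q0 : 0 < p / (p - 1) by rewrite divr_gt0//; move: p2; lra.
have W0 : 0 <= W by apply: Rintegral_ge0 => w _; exact: powR_ge0.
have X0' : 0 <= X by rewrite addr_ge0 ?powR_ge0// sumr_ge0// => l _; exact: powR_ge0.
suff WX : W <= p / (p - 1) * (W `^ (1 - p^-1) * X).
  have [->|Wn0] := eqVneq W 0; first exact: powR_ge0.
  have Wp : 0 < W by rewrite lt0r Wn0.
  rewrite -[leLHS](@powRVK _ W p)//; apply: le_powR; [exact: ltW|exact: powR_ge0|].
  rewrite -(@ler_pM2l _ (W `^ (1 - p^-1))) ?powR_gt0// -powRD_gt0// subrK powRr1//.
  by rewrite mulrCA.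
have iaS n : intg (fun w => `| `|S n w| | `^ p).
  by under eq_fun do rewrite normr_id; exact: iSp.
have maS n : mfun (fun w => `|S n w|) by exact: measurableT_comp.
have igS (m : 'I_N) : intg (fun w => g m w * `|S m.+1 w|).
  exact: (intg_M_mul (mg m) (fun w => g_le w (ltn_ord m)) (maS m.+1) (iaS m.+1)).
have isum := intg_sum (index_enum 'I_N) (Q := xpredT) (fun m _ => igS m).
have H1 : W <= p / (p - 1) * \sum_(m < N) \int[P]_w (g m w * `|S m.+1 w|).
  rewrite -(Rintegral_sum _ igS) -(RintegralZl _ measurableT isum).
  apply: (le_Rintegral measurableT (intg_running_max N) (intgZ _ isum)) => w _.
  under eq_bigr do rewrite mulrC.
  apply: running_max_powR_le => //; move: p2; lra.
apply: (le_trans H1); rewrite ler_pM2l//.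
apply: (@le_trans _ _ (\sum_(m < N) (\int[P]_w (g m w * `|S N w|) +
    \sum_(l < r) \int[P]_w (g m w * Z r l w)))).
  by apply: ler_sum => m _; exact: past_increment.
rewrite big_split exchange_big/= mulrDr mulr_sumr; apply: lerD.
  exact: (Rintegral_M_mul N (fun w => normr_ge0 (S N w)) (maS N) (iSp N)).
apply: ler_sum => l _; rewrite -EZ.
exact: (Rintegral_M_mul N (Z0 r l) (mZ r l) (iZ r l)).
Qed.
End stationary_inequalities.

(** * Dyadic bounds and the passage to general [n] *)

Lemma powR_quasi_subadditive (R : realType) (c t a x y : R) : 0 <= c -> 0 <= t ->
  0 <= a -> 0 <= x -> 0 <= y -> a <= c * (x + y) ->
  a `^ t <= c `^ t * 2 `^ t * (x `^ t + y `^ t).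
Proof.
move=> c0 t0 a0 x0 y0 axy; have xy0 : 0 <= x + y by exact: addr_ge0.
apply: (le_trans (le_powR t0 a0 axy)); rewrite powRM// -mulrA.
by rewrite ler_wpM2l ?powR_ge0//; exact: powRD_le.
Qed.

Lemma running_max_homo (R : realType) (u : nat -> R) :
  {homo running_max u : m n / (m <= n)%N >-> m <= n}.
Proof.
move=> m n /subnK <-; elim: (n - m)%N => // k IH.
exact: le_trans IH (running_maxS _ _).
Qed.

Lemma bigmax_powR (R : realType) (u : nat -> R) (p : R) n : 0 < p ->
  (forall k, 0 <= u k) ->
  \big[Num.max/0]_(1 <= j < n.+1) (u j `^ p) = running_max u n `^ p.
Proof.
move=> p0 u0; apply/le_anti/andP; split.
  rewrite big_seq; apply: bigmax_le => [|j]; first exact: powR_ge0.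
  rewrite mem_index_iota => jn; apply: le_powR; [exact: ltW|exact: u0|].
  exact: running_max_le.
have [->|[j jn ->]] : running_max u n = 0 \/ exists2 j, (0 < j <= n)%N & running_max u n = u j.
  elim: n => [|n IH]; [by left|right => /=].
  have [uM|Mu] := ltP (u n.+1) (running_max u n); last first.
    by exists n.+1; first exact: leqnn.
  case: IH => [M0|[j /andP[j0 jn] Mj]].
    by move: uM; rewrite M0 ltNge u0.
  by exists j; [rewrite j0 leqW|].
- by rewrite powR0 ?gt_eqF//; exact: bigmax_ge_id.
- by apply: (@le_bigmax_seq _ _ _ _ 0 j xpredT (fun j => u j `^ p)) => //; rewrite mem_index_iota.
Qed.

Lemma Lnorm_EFin d (Omega : measurableType d) (R : realType)
    (P : probability Omega R) (r : R) (f : Omega -> R) :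
  P.-integrable setT (EFin \o (fun w => `|f w| `^ r)) ->
  ('N[P]_r%:E[EFin \o f])%E = ((\int[P]_w (`|f w| `^ r))%R `^ r^-1)%:E.
Proof.
by move=> iF; rewrite unlock -poweR_EFin fineK ?integrable_fin_num.
Qed.

Section dyadic_bound.
Context (R : realType) (p : R).
Local Notation delta := (rosenthal_delta p).
Local Notation dyadic t f s := ((2 ^ s)%:R `^ (- t) * f (2 ^ s)%N `^ t).

Lemma dyadic_moment_bound : 2 < p -> exists2 D : R, 0 <= D &
  forall (d : measure_display) (Omega : measurableType d) (P : probability Omega R)
    (T Ti : Omega -> Omega) (F0 : set (set Omega)) (X0 : Omega -> R),
  stationary_adapted_Lp P p T Ti F0 X0 ->
  let S := partial_sum (shift_process T Ti X0) in
  let U n := \int[P]_w (`|condexp P F0 (S n) w| `^ p) in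
  let V n := \int[P]_w (`|condexp P F0 (fun w => S n w ^+ 2) w| `^ (p / 2)) in
  forall r, \int[P]_w (running_max (fun j => `|S j w|) (2 ^ r) `^ p) <=
    D * (2 ^ r)%:R * (\int[P]_w (`|S 1%N w| `^ p) +
      (\sum_(s < r) dyadic p^-1 U s) `^ p +
      (\sum_(s < r) dyadic (2 * delta / p) V s) `^ (p / (2 * delta))).
Proof.
move=> p2; have p0 : 0 < p by lra.
have [de0 de1 _] := rosenthal_deltaP p2.
have [C C0 HC] := powR_norm_add p2.
have t10 : 0 < p^-1 <= 1 by rewrite invr_gt0 p0/= invf_le1//; lra.
have t20 : 0 < 2 * delta / p <= 1.
  by apply/andP; split; [rewrite divr_gt0// mulr_gt0|rewrite ler_pdivrMr//; lra].
have C20 : 0 <= p + 2 * C by lra.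
have [D D0 HD] := rosenthal_recursion C20 t10 t20.
pose q := p / (p - 1).
have q0 : 0 < q by rewrite divr_gt0//; lra.
(* [q^p] is Doob's constant and [2^p] splits the power of a sum; [D] bounds the moment of the last
   partial sum, and 1 accounts for the chaining sum. *)
exists (q `^ p * 2 `^ p * (D + 1)).
  by rewrite !mulr_ge0 ?powR_ge0//; lra.
(* Writing [N^-1] as [N^-(1-t) N^-t] normalizes the moment and produces the weights [(2^s)^-t] of
   the dyadic sums. *)
have NtE (N a x t : R) : 0 < N -> 0 <= a ->
    (N^-1 * a) `^ (1 - t) * (N `^ (- t) * x) = N^-1 * (a `^ (1 - t) * x).
  move=> N0 a0; rewrite powRM ?invr_ge0// ?ltW// -(powR_inv1 (ltW N0)) -powRrM.
  rewrite mulrACA -powRD_gt0//.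
  by rewrite (_ : -1 * (1 - t) + - t = -1) ?mulrA//; ring.
have recnum (N a2 a u v : R) : 0 < N -> 0 <= a ->
    a2 <= 2 * a + (p * (a `^ (1 - p^-1) * u `^ p^-1) +
      2 * C * (a `^ (1 - 2 * delta / p) * v `^ (2 * delta / p))) ->
    (2 * N)^-1 * a2 <= N^-1 * a + (p + 2 * C) *
      ((N^-1 * a) `^ (1 - p^-1) * (N `^ (- p^-1) * u `^ p^-1) +
       (N^-1 * a) `^ (1 - 2 * delta / p) *
         (N `^ (- (2 * delta / p)) * v `^ (2 * delta / p))).
  move=> N0 a0; rewrite !NtE//.
  have := mulr_ge0 (powR_ge0 a (1 - p^-1)) (powR_ge0 u p^-1).
  have := mulr_ge0 (powR_ge0 a (1 - 2 * delta / p)) (powR_ge0 v (2 * delta / p)).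
  move: (a `^ _ * _) (a `^ _ * _) => y x y0 x0 HH.
  rewrite -mulrDr mulrCA -mulrDr invfM mulrAC (mulrC _ N^-1) ler_pM2l ?invr_gt0//.
  have := mulr_ge0 (ltW p0) y0; have := mulr_ge0 C0 x0; have := mulr_ge0 (ltW p0) x0.
  have := mulr_ge0 C0 y0; move: HH; lra.
have numfin (N A1 AN a b W : R) : 0 < N -> 0 <= A1 -> 0 <= AN -> 0 <= a -> 0 <= b ->
    N^-1 * AN <= D * (A1 + a `^ p + b) ->
    W <= (q * (AN `^ p^-1 + N `^ p^-1 * a)) `^ p ->
    W <= q `^ p * 2 `^ p * (D + 1) * N * (A1 + a `^ p + b).
  move=> N0 A10 AN0 a0 b0; rewrite ler_pdivrMl// => HA HM; apply: (le_trans HM).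
  have r0 : 0 <= p by exact: ltW.
  have Na0 : 0 <= N `^ p^-1 * a by rewrite mulr_ge0 ?powR_ge0.
  rewrite powRM; [|exact: ltW|by rewrite addr_ge0 ?powR_ge0].
  rewrite -!mulrA ler_wpM2l ?powR_ge0//.
  apply: (le_trans (powRD_le r0 (powR_ge0 _ _) Na0)).
  rewrite ler_wpM2l ?powR_ge0// powRVK// powRM ?powR_ge0// powRVK ?(ltW N0)//.
  have ap0 : 0 <= a `^ p by exact: powR_ge0.
  have := mulr_ge0 (ltW N0) A10; have := mulr_ge0 (ltW N0) b0.
  move: HA; lra.
move=> d Omega P T Ti F0 X0 H S U V r.
pose A n := \int[P]_w (`|S n w| `^ p).
have A0 n : 0 <= A n by apply: Rintegral_ge0 => w _; exact: powR_ge0.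
have U0 n : 0 <= U n by apply: Rintegral_ge0 => w _; exact: powR_ge0.
have V0 n : 0 <= V n by apply: Rintegral_ge0 => w _; exact: powR_ge0.
have N0 s : 0 < (2 ^ s)%:R :> R by rewrite ltr0n expn_gt0.
have rec s : (2 ^ s.+1)%:R^-1 * A (2 ^ s.+1)%N <= (2 ^ s)%:R^-1 * A (2 ^ s)%N +
   (p + 2 * C) * (((2 ^ s)%:R^-1 * A (2 ^ s)%N) `^ (1 - p^-1) * dyadic p^-1 U s +
     ((2 ^ s)%:R^-1 * A (2 ^ s)%N) `^ (1 - 2 * delta / p) * dyadic (2 * delta / p) V s).
  have E : (2 ^ s.+1 = 2 ^ s + 2 ^ s)%N by rewrite addnn -mul2n -expnS.
  have E' : (2 ^ s.+1)%:R = 2 * (2 ^ s)%:R :> R by rewrite expnS natrM.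
  rewrite E' E.
  exact: (recnum _ _ _ _ _ (N0 s) (A0 _) (moment_doubling H p2 (2 ^ s)%N C0 HC)).
have HA : (2 ^ r)%:R^-1 * A (2 ^ r)%N <= D * (A 1%N +
      (\sum_(s < r) dyadic p^-1 U s) `^ p +
      (\sum_(s < r) dyadic (2 * delta / p) V s) `^ (p / (2 * delta))).
  have := HD (fun s => (2 ^ s)%:R^-1 * A (2 ^ s)%N) (fun s => dyadic p^-1 U s)
    (fun s => dyadic (2 * delta / p) V s) r.
  rewrite invrK invf_div expn0 invr1 mul1r; apply => [s|s|s|s _]; last exact: rec.
  - by rewrite mulr_ge0// invr_ge0 ltW.
  - by rewrite mulr_ge0 ?powR_ge0.
  - by rewrite mulr_ge0 ?powR_ge0.
(* The maximal inequality produces the same weighted sum of [U] as the recursion, up to the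
   normalization [(2^r)^(1/p)]. *)
have HE : \sum_(l < r) ((2 ^ (r - l))%:R * U (2 ^ l)%N) `^ p^-1 =
    (2 ^ r)%:R `^ p^-1 * \sum_(s < r) dyadic p^-1 U s.
  rewrite mulr_sumr; apply: eq_bigr => l _.
  have E2 : (2 ^ r)%:R = (2 ^ (r - l))%:R * (2 ^ l)%:R :> R.
    by rewrite -natrM -expnD subnK// ltnW.
  rewrite (powRM _ (ler0n _ _) (U0 _)) mulrA E2 (powRM _ (ler0n _ _) (ler0n _ _)).
  by rewrite -(mulrA (_ `^ _)) -powRD_gt0// subrr powRr0 mulr1.
have HM := stationary_maximal_inequality H p2 r.
have a0 : 0 <= \sum_(s < r) dyadic p^-1 U s.
  by apply: sumr_ge0 => s _; rewrite mulr_ge0 ?powR_ge0.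
rewrite HE in HM.
exact: (numfin _ _ _ _ _ _ (N0 r) (A0 _) (A0 _) a0 (powR_ge0 _ _) HA HM).
Qed.
End dyadic_bound.

Section bracket.
Context d (Omega : measurableType d) (R : realType) (P : probability Omega R).
Variables (p : R) (T Ti : Omega -> Omega) (F0 : set (set Omega)) (X0 : Omega -> R).
Hypotheses (H : stationary_adapted_Lp P p T Ti F0 X0) (p2 : 2 < p).
Local Notation S := (partial_sum (shift_process T Ti X0)).
Local Notation delta := (rosenthal_delta p).
Local Notation A := (\int[P]_w (`|S 1%N w| `^ p)).
Local Notation U n := (\int[P]_w (`|condexp P F0 (S n) w| `^ p)).
Local Notation V n := (\int[P]_w (`|condexp P F0 (fun w => S n w ^+ 2) w| `^ (p / 2))).

Lemma shift_filtration0 : shift_filtration T Ti F0 0 = F0.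
Proof.
apply/seteqP; split => [B [A' FA <-]|B FB] /=; first by rewrite preimage_id.
by exists B => //; rewrite preimage_id.
Qed.

Lemma expectation_max n :
  ('E_P[fun w => \big[Num.max/0%R]_(1 <= j < n.+1) (`|S j w| `^ p)%R] =
   (\int[P]_w (running_max (fun j => `|S j w|) n `^ p))%R%:E)%E.
Proof.
rewrite unlock /Rintegral fineK; last first.
  by apply: integrable_fin_num => //; exact: (intg_running_max H p2).
apply: eq_integral => w _; congr EFin.
apply: (@bigmax_powR R (fun j => `|S j w|)) => //; exact: lt_trans p2.
Qed.

(** All norms in the bracket are finite, so it reduces to a real number. The exponent [2 delta / p]
    is the power [delta] of a norm of order [p / 2]. *)
Lemma rosenthal_bracketE c n :
  rosenthal_bracket P p c (shift_process T Ti X0)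
    (condexp P (shift_filtration T Ti F0 0)) n =
  (n%:R * A + c * n%:R *
     (\sum_(1 <= k < n.+1) (k%:R `^ (1 + p^-1))^-1 * U k `^ p^-1) `^ p +
   n%:R * (\sum_(1 <= k < n.+1) (k%:R `^ (1 + 2 * delta / p))^-1 *
     V k `^ (2 * delta / p)) `^ (p / (2 * delta)))%:E.
Proof.
rewrite /rosenthal_bracket shift_filtration0.
have p0 : 0 < p by exact: lt_trans p2.
have -> : ('E_P[fun w => (`|shift_process T Ti X0 1 w| `^ p)%R] = A%:E)%E.
  rewrite unlock /Rintegral fineK; last first.
    by apply: integrable_fin_num => //; exact: (intg_partial_sum H p2).
  by apply: eq_integral => w _; rewrite partial_sumE big_nat1.
have -> : (\sum_(1 <= k < n.+1) ((k%:R `^ (1 + p^-1))^-1)%R%:E *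
      'N[P]_p%:E[EFin \o condexp P F0 (S k)] =
    (\sum_(1 <= k < n.+1) (k%:R `^ (1 + p^-1))^-1 * U k `^ p^-1)%R%:E)%E.
  rewrite -sumEFin; apply: eq_bigr => k _.
  by rewrite (Lnorm_EFin (proj1 (condexp_sum_moment H p2 k))).
have -> : (\sum_(1 <= k < n.+1) ((k%:R `^ (1 + 2 * delta / p))^-1)%R%:E *
      'N[P]_(p / 2)%:E[EFin \o condexp P F0 (fun w => S k w ^+ 2)%R] `^ delta =
    (\sum_(1 <= k < n.+1) (k%:R `^ (1 + 2 * delta / p))^-1 *
       V k `^ (2 * delta / p))%R%:E)%E.
  rewrite -sumEFin; apply: eq_bigr => k _.
  rewrite (Lnorm_EFin (proj1 (condexp_sqr_moment H p2 k))) poweR_EFin -powRrM.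
  have -> : (p / 2)^-1 * delta = 2 * delta / p by field; rewrite gt_eqF.
  by [].
by [].
Qed.
End bracket.

(** The parameter [c] treats both claims at once. For [c = 0], each dyadic term in [U] is at most
    the power [(2 delta)^-1] of the one in [V], by [U <= V] and the matching of weights
    [t2 / (2 delta) = t1]; since this power is at least 1, it can be taken outside the sum. *)
Lemma rosenthal_moment_bound (R : realType) (p c : R)
    (delta := rosenthal_delta p) : 2 < p -> c = 1 \/ (c = 0 /\ 4 <= p) ->
  exists C : R, forall (d : measure_display) (Omega : measurableType d)
    (P : probability Omega R) (T Ti : Omega -> Omega) (F0 : set (set Omega))
    (X0 : Omega -> R),
  stationary_adapted_Lp P p T Ti F0 X0 ->
  let S := partial_sum (shift_process T Ti X0) in
  let U n := \int[P]_w (`|condexp P F0 (S n) w| `^ p) in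
  let V n := \int[P]_w (`|condexp P F0 (fun w => S n w ^+ 2) w| `^ (p / 2)) in
  forall n, (0 < n)%N ->
  \int[P]_w (running_max (fun j => `|S j w|) n `^ p) <=
  C * (n%:R * \int[P]_w (`|S 1%N w| `^ p) + c * n%:R *
     (\sum_(1 <= k < n.+1) (k%:R `^ (1 + p^-1))^-1 * U k `^ p^-1) `^ p +
   n%:R * (\sum_(1 <= k < n.+1) (k%:R `^ (1 + 2 * delta / p))^-1 *
     V k `^ (2 * delta / p)) `^ (p / (2 * delta))).
Proof.
(* [Y] is counted twice because for [c = 0] both [e] and [z] are bounded by [Y y]. *)
have arith (e z A x y X Y : R) : 0 <= A -> 0 <= x -> 0 <= y -> 0 <= X -> 0 <= Y ->
    z <= Y * y -> (c = 1 /\ e <= X * x) \/ (c = 0 /\ e <= z) ->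
    A + e + z <= (1 + X + 2 * Y) * (A + c * x + y).
  move=> A0 x0 y0 X0 Y0 zB.
  have := mulr_ge0 X0 A0; have := mulr_ge0 Y0 A0; have := mulr_ge0 X0 y0.
  have := mulr_ge0 Y0 x0; have := mulr_ge0 Y0 y0.
  by move=> ? ? ? ? ? [[-> eB]|[-> eB]]; lra.
have factor (D K m A x y : R) : 2 * D * K * (m * A + c * m * x + m * y) =
    D * (2 * m) * (K * (A + c * x + y)) by ring.
move=> p2 cP; have p0 : 0 < p by lra.
have [de0 de1 deP] := rosenthal_deltaP p2; rewrite -/delta in de0 de1 deP.
have i1 : 4 <= p -> 1 <= (2 * delta)^-1.
  move=> p4; rewrite invf_ge1 ?mulr_gt0//; case: deP => -[p3 dE]; first lra.
  have : delta * 2 <= delta * (p - 2) by rewrite ler_wpM2l ?(ltW de0)//; lra.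
  by rewrite dE mulrC.
have [D D0] := dyadic_moment_bound p2; rewrite -/delta.
set t1 := p^-1; set t2 := 2 * delta / p; set tau := p / (2 * delta) => HD.
have t10 : 0 <= t1 by rewrite invr_ge0 ltW.
have t20 : 0 <= t2 by rewrite divr_ge0 ?mulr_ge0 ?ltW.
have tau0 : 0 <= tau by rewrite divr_ge0 ?mulr_ge0 ?ltW.
(* Quasi-subadditivity constant of [U^t] and [V^t]: the factor [2^p] raised to [t], times [2^t] for
   the power of a sum. *)
pose K t : R := (2 `^ p) `^ t * 2 `^ t.
have K0 t : 0 <= K t by rewrite mulr_ge0 ?powR_ge0.
pose C t : R := 1 + 2 * K t + 16 * K t * 4 `^ t.
have C0 t : 0 <= C t.
  by rewrite /C !addr_ge0 ?mulr_ge0 ?powR_ge0.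
have [tau_mul pE] : t2 * tau = 1 /\ (2 * delta)^-1 * p = tau.
  by split; [rewrite /t2 /tau; field; rewrite !gt_eqF|rewrite /tau mulrC].
have tU : t2 * (2 * delta)^-1 = t1.
  by rewrite /t2 /t1; field; rewrite !gt_eqF.
clearbody t1 t2 tau.
have numfin (m N A e z a b W : R) : 0 <= m -> N <= 2 * m -> 0 <= A -> 0 <= e ->
    0 <= z -> 0 <= a -> 0 <= b -> (4 <= p -> e <= z `^ (2 * delta)^-1) ->
    e <= C t1 * a -> z <= C t2 * b -> W <= D * N * (A + e `^ p + z `^ tau) ->
    W <= 2 * D * (1 + C t1 `^ p + 2 * C t2 `^ tau) *
         (m * A + c * m * a `^ p + m * b `^ tau).
  move=> m0 Nm A0 e0 z0 a0 b0 ez ea zb /le_trans; apply.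
  have ep0 := powR_ge0 e p; have zp0 := powR_ge0 z tau.
  apply: (@le_trans _ _ (D * (2 * m) * (A + e `^ p + z `^ tau))).
    by rewrite ler_wpM2r ?addr_ge0// ler_wpM2l.
  have zB : z `^ tau <= C t2 `^ tau * b `^ tau.
    by rewrite -powRM//; exact: le_powR.
  rewrite factor; apply: ler_wpM2l; first by rewrite !mulr_ge0.
  apply: (arith _ _ _ _ _ _ _ A0 (powR_ge0 a p) (powR_ge0 b tau)
    (powR_ge0 (C t1) p) (powR_ge0 (C t2) tau) zB).
  case: cP => [c1|[c0 p4]]; [left|right]; split => //.
    by rewrite -powRM//; apply: le_powR => //; exact: ltW.
  by rewrite -pE powRrM; apply: le_powR => //; [exact: ltW|exact: ez].
exists (2 * D * (1 + C t1 `^ p + 2 * C t2 `^ tau)).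
move=> d Omega P T Ti F0 X0 H S U V n n0.
have U0 k : 0 <= U k by apply: Rintegral_ge0 => w _; exact: powR_ge0.
have V0 k : 0 <= V k by apply: Rintegral_ge0 => w _; exact: powR_ge0.
have UV k : U k <= V k by exact: (condexp_sum_le_sqr H p2).
have US i j : U (i + j)%N <= 2 `^ p * (U i + U j) by exact: (condexp_sum_subadditive H p2).
have VS i j : V (i + j)%N <= 2 `^ p * (V i + V j) by exact: (condexp_sqr_subadditive H p2).
have [rn1 rn2] : (2 ^ trunc_log 2 n <= n)%N /\ (n <= 2 ^ (trunc_log 2 n).+1)%N.
  by have /andP[? /ltnW ?] := trunc_log_bounds (isT : (1 < 2)%N) n0.
(* This [r] gives [n <= 2^r <= 2 n], while the dyadic sums over [s < r] involve only indices
   [2^s <= n], as sums stopping at [n] require. *)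
set r := (trunc_log 2 n).+1 in rn2.
have r2n : (2 ^ r)%:R <= 2 * n%:R :> R by rewrite -natrM ler_nat expnS leq_pmul2l.
have rsn s : (s < r)%N -> (2 ^ s <= n)%N.
  by move=> sr; apply: leq_trans rn1; rewrite leq_exp2l.
have HW := HD _ _ P T Ti F0 X0 H r.
have e0 : 0 <= \sum_(s < r) ((2 ^ s)%:R `^ (- t1) * U (2 ^ s)%N `^ t1).
  by apply: sumr_ge0 => s _; rewrite mulr_ge0 ?powR_ge0.
have z0 : 0 <= \sum_(s < r) ((2 ^ s)%:R `^ (- t2) * V (2 ^ s)%N `^ t2).
  by apply: sumr_ge0 => s _; rewrite mulr_ge0 ?powR_ge0.
have swap (t : R) (f : nat -> R) : \sum_(1 <= k < n.+1) f k * (k%:R `^ (1 + t))^-1 =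
    \sum_(1 <= k < n.+1) (k%:R `^ (1 + t))^-1 * f k.
  by apply: eq_bigr => k _; rewrite mulrC.
have ea := @dyadic_sum_le R (K t1) t1 (fun k => U k `^ t1) r n (K0 t1) t10
  (fun k => powR_ge0 _ _) (fun i j => powR_quasi_subadditive (powR_ge0 2 p) t10
    (U0 _) (U0 i) (U0 j) (US i j)) rsn.
have zb := @dyadic_sum_le R (K t2) t2 (fun k => V k `^ t2) r n (K0 t2) t20
  (fun k => powR_ge0 _ _) (fun i j => powR_quasi_subadditive (powR_ge0 2 p) t20
    (V0 _) (V0 i) (V0 j) (VS i j)) rsn.
have ez : 4 <= p -> \sum_(s < r) ((2 ^ s)%:R `^ (- t1) * U (2 ^ s)%N `^ t1) <=
    (\sum_(s < r) ((2 ^ s)%:R `^ (- t2) * V (2 ^ s)%N `^ t2)) `^ (2 * delta)^-1.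
  move=> p4; apply: le_trans (sum_powR_le r (i1 p4) (b := fun s => (2 ^ s)%:R `^ (- t2) * V (2 ^ s)%N `^ t2) _).
    apply: ler_sum => s _; rewrite powRM ?powR_ge0// -!powRrM mulNr tU.
    apply: ler_wpM2l; first exact: powR_ge0.
    exact: le_powR t10 (U0 _) (UV _).
  by move=> s; rewrite mulr_ge0 ?powR_ge0.
rewrite swap in ea; rewrite swap in zb.
have A0 : 0 <= \int[P]_w (`|S 1%N w| `^ p).
  by apply: Rintegral_ge0 => w _; exact: powR_ge0.
have a0 : 0 <= \sum_(1 <= k < n.+1) (k%:R `^ (1 + t1))^-1 * U k `^ t1.
  by apply: sumr_ge0 => k _; rewrite mulr_ge0 ?powR_ge0 ?invr_ge0 ?powR_ge0.
have b0 : 0 <= \sum_(1 <= k < n.+1) (k%:R `^ (1 + t2))^-1 * V k `^ t2.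
  by apply: sumr_ge0 => k _; rewrite mulr_ge0 ?powR_ge0 ?invr_ge0 ?powR_ge0.
have mono : \int[P]_w (running_max (fun j => `|S j w|) n `^ p) <=
    \int[P]_w (running_max (fun j => `|S j w|) (2 ^ r) `^ p).
  apply: (le_Rintegral measurableT (intg_running_max H p2 n) (intg_running_max H p2 _)).
  move=> w _; apply: le_powR; [exact: ltW|exact: running_max_ge0|].
  exact: running_max_homo.
exact: (numfin _ _ _ _ _ _ _ _ (ler0n R n) r2n A0 e0 z0 a0 b0 ez ea zb (le_trans mono HW)).
Qed.

Theorem theorem6 (R : realType) (p : R) (p_gt2 : 2 < p) :
  (exists C : R,
    forall (d : measure_display) (Omega : measurableType d)
      (P : probability Omega R) (T Ti : Omega -> Omega)
      (F0 : set (set Omega)) (X0 : Omega -> R),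
    stationary_adapted_Lp P p T Ti F0 X0 ->
    let X := shift_process T Ti X0 in
    let F := shift_filtration T Ti F0 in
    let E0 := condexp P (F 0) in
    forall n : nat, (0 < n)%N ->
    ('E_P[fun w => \big[Num.max/0%R]_(1 <= j < n.+1)
                     (`|partial_sum X j w| `^ p)%R]
     <= C%:E * rosenthal_bracket P p 1 X E0 n)%E)
  /\
  (4 <= p -> exists C : R,
    forall (d : measure_display) (Omega : measurableType d)
      (P : probability Omega R) (T Ti : Omega -> Omega)
      (F0 : set (set Omega)) (X0 : Omega -> R),
    stationary_adapted_Lp P p T Ti F0 X0 ->
    let X := shift_process T Ti X0 in
    let F := shift_filtration T Ti F0 in
    let E0 := condexp P (F 0) in
    forall n : nat, (0 < n)%N ->
    ('E_P[fun w => \big[Num.max/0%R]_(1 <= j < n.+1)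
                     (`|partial_sum X j w| `^ p)%R]
     <= C%:E * rosenthal_bracket P p 0 X E0 n)%E).
Proof.
have bound c : c = 1 \/ (c = 0 /\ 4 <= p) -> exists C : R,
    forall (d : measure_display) (Omega : measurableType d)
      (P : probability Omega R) (T Ti : Omega -> Omega)
      (F0 : set (set Omega)) (X0 : Omega -> R),
    stationary_adapted_Lp P p T Ti F0 X0 ->
    let X := shift_process T Ti X0 in
    let F := shift_filtration T Ti F0 in
    let E0 := condexp P (F 0) in
    forall n : nat, (0 < n)%N ->
    ('E_P[fun w => \big[Num.max/0%R]_(1 <= j < n.+1)
                     (`|partial_sum X j w| `^ p)%R]
     <= C%:E * rosenthal_bracket P p c X E0 n)%E.
  move=> cP; have [C HC] := rosenthal_moment_bound p_gt2 cP.
  exists C => d Omega P T Ti F0 X0 H X F E0 n n0.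
  rewrite (expectation_max H p_gt2) (rosenthal_bracketE H p_gt2) -EFinM lee_fin.
  exact: HC H _ n0.
split; first by apply: bound; left.
by move=> p4; apply: bound; right.
Qed.
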